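(* Let $\mathcal{A}\subset\mathbb{Z}$ be a finite alphabet, let $G=(V,E)$ be a finite directed graph with edge labelling $\ell:E\to\mathcal{A}$ with $M=\sum_{a\in\mathcal{A}}M_a$ primitive, let $\beta>1$ be a Pisot number, and let $\nu=(\phi^+)_*(\mu^+)$ as in the context. Then $\nu$ is absolutely continuous with respect to Lebesgue measure if and only if $$\lim_{k\to\infty}\widehat{\nu}(z\beta^k)=0\quad\text{for all }z\in\mathbb{Z}[\beta]\setminus\{0\}.$$
   Context: For $a\in\mathcal{A}$, $M_a$ is the $V\times V$ matrix with $(M_a)_{ij}=1$ if $(i,j)\in E$ and $\ell((i,j))=a$, and $0$ otherwise. By Perron–Frobenius, $M$ has a dominant eigenvalue $\lambda>0$ with positive left eigenvector $\mathbf v_L$ and right eigenvector $\mathbf v_R$, normalised by $\mathbf v_L^{\mathsf T}\mathbf v_R=1$. $\mathcal{K}^+\subseteq\mathcal{A}^{\mathbb{N}}$ is the set of sequences $(\ell(e_k))_{k\ge1}$ for infinite paths $e_1e_2\ldots$ in $G$ (terminal vertex of $e_j$ equals initial vertex of $e_{j+1}$), and $\mu^+$ the Borel probability measure on $\mathcal{K}^+$ with $\mu^+(\{x:x_1=\varepsilon_1,\ldots,x_k=\varepsilon_k\})=\lambda^{-k}\mathbf v_L^{\mathsf T}M_{\varepsilon_1}\cdots M_{\varepsilon_k}\mathbf v_R$. A Pisot number is an algebraic integer $>1$ all of whose other Galois conjugates have modulus $<1$ (integers $\ge2$ included). $\phi^+((x_k)_{k\ge1})=\sum_{k\ge1}x_k\beta^{-k}$,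 $\nu(A)=\mu^+((\phi^+)^{-1}(A))$, and $\widehat{\nu}(t)=\int e^{-2\pi i x t}\,d\nu(x)$. *)

(* Defs.v *)
From HB Require Import structures.
From mathcomp Require Import all_boot all_order all_algebra.
From mathcomp Require Import all_classical all_reals all_analysis.
From mathcomp Require Import complex.

Set Implicit Arguments.
Unset Strict Implicit.
Unset Printing Implicit Defensive.

Import Order.TTheory GRing.Theory Num.Theory.
Import numFieldNormedType.Exports.

Local Open Scope classical_set_scope.
Local Open Scope ring_scope.

(* Graph data: vertex set V = 'I_n.+1, edge set E given as a relation  *)
(* on V (E ⊆ V × V), labelling ell : E -> Z (only its values on edges  *)
(* matter).                                                            *)

Definition labmx (R : nzRingType) (n : nat) (E : rel 'I_n.+1)
    (ell : 'I_n.+1 -> 'I_n.+1 -> int) (a : int) : 'M[R]_n.+1 :=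
  \matrix_(i, j) ((E i j) && (ell i j == a))%:R.

Definition adjmx (R : nzRingType) (n : nat) (A : seq int) (E : rel 'I_n.+1)
    (ell : 'I_n.+1 -> 'I_n.+1 -> int) : 'M[R]_n.+1 :=
  \sum_(a <- A) labmx R E ell a.

Definition primitive_mx (R : numDomainType) (n : nat) (M : 'M[R]_n.+1) :=
  (forall i j, 0 <= M i j) /\ exists k : nat, forall i j, 0 < (M ^+ k) i j.

Definition intpoly_to (F : nzRingType) (p : {poly int}) : {poly F} :=
  map_poly (fun c : int => c%:~R) p.

(* beta is an algebraic integer > 1 whose minimal polynomial (a monic,
   Q-irreducible integer polynomial having beta as a root) has all its other
   complex roots of modulus < 1. *)
Definition pisot (R : realType) (beta : R) : Prop :=
  1 < beta /\
  exists p : {poly int},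
    [/\ p \is monic,
        irreducible_poly (intpoly_to rat p),
        root (intpoly_to R p) beta &
        forall z : R[i], root (intpoly_to R[i] p) z ->
          z != (beta%:C)%C -> `|z| < 1].

Definition Zbeta (R : realType) (beta : R) : set R :=
  [set z | exists p : {poly int}, z = (intpoly_to R p).[beta]].

(* Sequences are indexed from 0: x 0 is the first letter x_1.          *)

(* int as a pointed type (point 0), needed for the sigma-algebra type *)
HB.instance Definition _ := isPointed.Build int 0%R.

Definition cylinder (w : seq int) : set (nat -> int) :=
  [set x | forall k, (k < size w)%N -> x k = nth 0 w k].

Definition cylinders : set (set (nat -> int)) := range cylinder.

Notation seqspace := (g_sigma_algebraType cylinders).

Definition phiplus (R : realType) (beta : R) (x : nat -> int) : R :=
  limn (fun N => \sum_(k < N) ((x k)%:~R / beta ^+ k.+1)).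

(* nu-hat(t) = \int e^{-2 pi i x t} d nu(x)
             = \int cos(2 pi x t) d nu - i \int sin(2 pi x t) d nu *)
Definition fourier (R : realType)
    (nu : {measure set (measurableTypeR R) -> \bar R}) (t : R) : R[i] :=
  ((\int[nu]_x cos (2 * pi * x * t)) -i* (\int[nu]_x sin (2 * pi * x * t)))%C.

(* Main.v *)
Require Import Defs.
From HB Require Import structures.
From mathcomp Require Import all_boot all_order all_algebra.
From mathcomp Require Import all_classical all_reals all_analysis.
From mathcomp Require Import measurable_realfun complex.
From mathcomp Require Import ring lra.

Set Implicit Arguments.
Unset Strict Implicit.
Unset Printing Implicit Defensive.

Import Order.TTheory GRing.Theory Num.Theory.
Import numFieldNormedType.Exports.

Local Open Scope classical_set_scope.
Local Open Scope ring_scope.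

(* If nu is absolutely continuous, the limit is the Riemann-Lebesgue lemma.
   Conversely we bound nu(I) by C |I| for every short interval I.  Let d be the
   degree of beta, sigma the shift and X = phi^+.  Then
   beta^k X = Y_k + X o sigma^k with Y_k in Z[beta], and modulo Z^d the vector
   (Y_k beta^i)_{i < d} lies in a bounded part of a fixed hyperplane (the sum of
   the contracting eigenspaces), because beta^m is an integer up to a summable
   error r_m satisfying a recurrence of order d - 1.  Hence, when X o sigma^k
   lies in an interval of length of order 1/L, the point (beta^k X beta^i)_{i < d}
   of the torus is within O(1/L) of one of O(L^(d-1)) grid points.  Summing
   d-dimensional Fejer kernels centred at these points gives a nonnegative
   trigonometric polynomial h with frequencies in Z[beta] and mean O(1/L) such
   that h(beta^k X) >= 1 on that event.  Since mu^+ is shift invariant,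
   nu(I) <= E h(beta^k X), which tends to the mean of h by hypothesis. *)

(** * The recurrence attached to a Pisot number *)

Lemma intpoly_to_ratr (F : numFieldType) (p : {poly int}) :
  map_poly (@ratr F) (intpoly_to rat p) = intpoly_to F p.
Proof.
rewrite /intpoly_to; apply/polyP => i.
by rewrite !coef_map_id0 ?rmorph0 ?ratr_int ?rmorph0 ?ratr_int.
Qed.

Lemma coef_intpoly_to (F : nzRingType) (p : {poly int}) i :
  (intpoly_to F p)`_i = (p`_i)%:~R.
Proof. by rewrite coef_map_id0. Qed.

Lemma size_intpoly_to (F : numDomainType) (p : {poly int}) :
  size (intpoly_to F p) = size p.
Proof.
by apply: size_map_inj_poly => // x y /eqP; rewrite eqr_int => /eqP.
Qed.

(* Bezout over the rationals survives the embedding in F. *)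
Lemma irreducible_root_horner_neq0 (F : numFieldType) (p f : {poly int}) (x : F) :
  irreducible_poly (intpoly_to rat p) -> root (intpoly_to F p) x ->
  f != 0 -> (size f < size p)%N -> (intpoly_to F f).[x] != 0.
Proof.
move=> irrp rootx f0 szf; rewrite -intpoly_to_ratr.
apply: (@coprimep_root _ (intpoly_to F p)) => //.
rewrite -intpoly_to_ratr coprimep_map.
rewrite irreducible_poly_coprime //; apply/negP => /dvdp_leq.
rewrite !size_intpoly_to leqNgt szf => /(_ _)/negP; apply => //.
by rewrite -size_poly_eq0 size_intpoly_to size_poly_eq0.
Qed.

(** [Q] evaluated at the shift operator and applied to [u]; its vanishing for all [m] is the linear
    recurrence with characteristic polynomial [Q]. *)
Definition recur (F : nzRingType) (Q : {poly F}) (u : nat -> F) (m : nat) : F :=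
  \sum_(i < size Q) Q`_i * u (m + i)%N.

Lemma recurE (F : nzRingType) (Q : {poly F}) (u : nat -> F) (m N : nat) :
  (size Q <= N)%N -> recur Q u m = \sum_(i < N) Q`_i * u (m + i)%N.
Proof.
move=> QN; rewrite /recur (big_ord_widen N (fun i => Q`_i * u (m + i)%N)) //.
rewrite big_mkcond; apply: eq_bigr => i _; case: ltnP => // h.
by rewrite nth_default // mul0r.
Qed.

(** Evaluation at the shift operator is multiplicative, so a linear factor of the characteristic
    polynomial can be moved onto the sequence. *)
Lemma recurM_XsubC (F : comNzRingType) (Q : {poly F}) (c : F) (u : nat -> F) m :
  recur (('X - c%:P) * Q) u m = recur Q (fun k => u k.+1 - c * u k) m.
Proof.
pose N := (size Q).+1.
have sz : (size (('X - c%:P) * Q)%R <= N.+1)%N.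
  by rewrite (leq_trans (size_polyMleq _ _)) // size_XsubC.
rewrite (recurE _ _ sz) (@recurE _ Q _ _ N); last exact: leqW.
rewrite (eq_bigr (fun i : 'I_N.+1 =>
  ('X * Q)`_i * u (m + i)%N - c * (Q`_i * u (m + i)%N))); last first.
  by move=> i _; rewrite mulrBl coefB coefCM mulrBl mulrA.
rewrite sumrB big_ord_recl coefXM eqxx mul0r add0r.
rewrite [X in _ - X]big_ord_recr /= [Q`_N]nth_default ?leqnSn // mul0r mulr0 addr0.
rewrite -sumrB; apply: eq_bigr => i _.
rewrite coefXM /= /bump /= add1n addnS; ring.
Qed.

(* Each root contracts, so a solution is recovered from a summable one with
   one root fewer. *)
Lemma recur_summable (F : numFieldType) (s : seq F) (u : nat -> F) :
  all (fun z => `|z| < 1) s ->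
  (forall m, recur (\prod_(z <- s) ('X - z%:P)) u m = 0) ->
  exists C, forall M, \sum_(m < M) `|u m| <= C.
Proof.
elim: s u => [|z s IH] u /=.
  move=> _ h; exists 0 => M; rewrite big1 // => m _.
  have := h m; rewrite big_nil /recur size_poly1 big_ord1 coef1 eqxx mul1r addn0.
  by move=> ->; rewrite normr0.
move=> /andP[z1 alls] h.
have [|C hC] := IH (fun k => u k.+1 - z * u k) alls.
  by move=> m; rewrite -recurM_XsubC -(h m) big_cons.
have z1' : 0 < 1 - `|z| by rewrite subr_gt0.
(* Summing [|u k.+1| <= |u k.+1 - z * u k| + |z * u k|] gives [S <= |u 0| + C + |z| S] for a partial
   sum [S]; the constant solves this for [S]. *)
exists ((`|u 0%N| + C) / (1 - `|z|)) => M; rewrite ler_pdivlMr //.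
rewrite mulrBr mulr1 lerBlDr.
have -> : (\sum_(m < M) `|u m|) * `|z| = \sum_(m < M) `|z * u m| :> F.
  rewrite mulr_suml; apply: eq_bigr => i _; by rewrite normrM mulrC.
case: M => [|M].
  rewrite !big_ord0 addr0 addr_ge0 //.
  by have := hC 0%N; rewrite big_ord0.
rewrite big_ord_recl /= -addrA lerD2l big_ord_recr /=.
rewrite addrA; apply: ler_wpDr => //.
apply: (le_trans (y := \sum_(i < M) (`|u i.+1 - z * u i| + `|z * u i|))).
  apply: ler_sum => i _; rewrite /bump /= add1n -{1}(subrK (z * u i) (u i.+1)).
  exact: ler_normD.
by rewrite big_split /= lerD2r; exact: hC.
Qed.

Lemma horner_intpoly_to (F : comNzRingType) (a : nat -> int) d (x : F) :
  (intpoly_to F (\poly_(i < d) a i)).[x] = \sum_(i < d) (a i)%:~R * x ^+ i.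
Proof.
rewrite (@horner_coef_wide _ d); last first.
  apply: leq_trans (size_poly d a); rewrite /intpoly_to; exact: size_poly.
by apply: eq_bigr => i _; rewrite coef_intpoly_to coef_poly ltn_ord.
Qed.

(** The roots of [q] are roots of [p], and none of them is [beta] because [q] does not vanish there;
    hence all are conjugates in the open unit disc. *)
Lemma pisot_cofactor_roots (R : rcfType) (p : {poly int}) (beta : R) (q : {poly R}) :
  (forall z : R[i], root (intpoly_to R[i] p) z -> z != (beta%:C)%C -> `|z| < 1) ->
  intpoly_to R p = q * ('X - beta%:P) -> q.[beta] != 0 -> q \is monic ->
  exists2 s : seq R[i], all (fun z => `|z| < 1) s &
    map_poly (real_complex R) q = \prod_(z <- s) ('X - z%:P).
Proof.
move=> rootp pE q0 qm.
have [s sE] := closed_field_poly_normal (map_poly (real_complex R) q).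
have sE' : map_poly (real_complex R) q = \prod_(z <- s) ('X - z%:P).
  by rewrite sE lead_coef_map (monicP qm) rmorph1 scale1r.
exists s => //; apply/allP => z zs.
have rz : root (map_poly (real_complex R) q) z by rewrite sE' root_prod_XsubC.
apply: rootp.
  have -> : intpoly_to R[i] p = map_poly (real_complex R) (intpoly_to R p).
    apply/polyP => i; rewrite coef_intpoly_to coef_map coef_intpoly_to /=.
    by rewrite (rmorph_int (real_complex R)).
  by rewrite pE rmorphM rootM rz.
apply: contraNneq q0 => zE; move: rz; rewrite zE.
by rewrite fmorph_root => /rootP ->.
Qed.

(* [T m] is the integer [Tr (beta ^ m)], obtained without conjugates as the
   top coefficient of [p^`() * 'X^m] modulo [p] (Euler's trace formula). *)
Lemma pisot_approx (R : realType) (beta : R) : pisot beta ->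
  exists d (b : nat -> R) (T : nat -> int),
  [/\ b d = 1,
      forall m, \sum_(i < d.+1) b i * (beta ^+ (m + i) - (T (m + i)%N)%:~R) = 0,
      exists C, forall M, \sum_(m < M) `|beta ^+ m - (T m)%:~R| <= C &
      forall a : nat -> int, \sum_(i < d.+1) (a i)%:~R * beta ^+ i = 0 ->
        forall i, (i < d.+1)%N -> a i = 0].
Proof.
move=> [beta1 [p [pm irrp rootp rootC]]].
pose P := intpoly_to R p.
have Pm : P \is monic by rewrite /P /intpoly_to monic_map.
(* [d] is one less than the degree of [p]: the cofactor [q] below has degree [d], while [beta ^+ 0],
   ..., [beta ^+ d] are [d.+1] powers. *)
have szp : exists d, size p = d.+2.
  have := irrp.1; rewrite size_intpoly_to.
  by case: (size p) => [|[|d]] // _; exists d.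
have [d {}szp] := szp.
have szP : size P = d.+2 by rewrite size_intpoly_to.
have [q PE] : exists q, P = q * ('X - beta%:P) by apply/factor_theorem.
have qm : q \is monic by move: Pm; rewrite PE monicMr ?monicXsubC.
have q0 : q != 0 by exact: monic_neq0.
have szq : size q = d.+1.
  by move: szP; rewrite PE size_Mmonic ?monicXsubC // size_XsubC addn2 /= => -[].
have dP : (P^`()).[beta] = q.[beta].
  by rewrite PE derivM derivXsubC mulr1 !hornerE subrr mulr0 add0r.
have p0 : p^`() != 0.
  apply/negP => /eqP /(congr1 (fun r : {poly int} => r`_d)).
  rewrite coef_deriv coef0; move: pm; rewrite monicE lead_coefE szp /= => /eqP ->.
  by move/eqP; rewrite pnatr_eq0.
have dPE : P^`() = intpoly_to R p^`() by rewrite /P /intpoly_to deriv_map.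
(* The derivative of [p] is nonzero of smaller degree, so it cannot vanish at [beta]; the root is
   simple. *)
have qb0 : q.[beta] != 0.
  rewrite -dP dPE; apply: (irreducible_root_horner_neq0 irrp rootp) => //.
  by apply: lt_size_deriv; apply: monic_neq0.
pose rem m := Pdiv.Ring.rmodp (p^`() * 'X^m) p.
have remE m : exists K : {poly int}, p^`() * 'X^m = K * p + rem m.
  by exists (Pdiv.Ring.rdivp (p^`() * 'X^m) p); exact: Pdiv.RingMonic.rdivp_eq.
have szrem m : (size (rem m) <= d.+1)%N.
  by rewrite -ltnS -szp Pdiv.Ring.ltn_rmodpN0 // monic_neq0.
pose T m : int := (rem m)`_d.
have rec m : \sum_(i < d.+1) q`_i * (beta ^+ (m + i) - (T (m + i)%N)%:~R) = 0.
  (* [g] equals [f(beta) q]: the two are congruent modulo [P] and both have degree below that of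
     [P]. The coefficients of degree [d] then give the recurrence, because
     [f(beta) = q(beta) beta^m]. *)
  pose g := \sum_(i < d.+1) q`_i *: intpoly_to R (rem (m + i)%N).
  have szg : (size g <= d.+1)%N.
    apply: (leq_trans (size_sum _ _ _)); apply/bigmax_leqP => i _.
    by rewrite (leq_trans (size_scale_leq _ _)) // size_intpoly_to.
  pose f := P^`() * 'X^m.
  have Pg : P %| g - f.[beta] *: q.
    (* The first term is a multiple of [q * ('X - beta%:P) = P]; in the sum each [f * 'X^i] differs
       from its remainder by a multiple of [P]. *)
    have -> : g - f.[beta] *: q = q * (f - f.[beta]%:P)
        - \sum_(i < d.+1) q`_i *: (f * 'X^i - intpoly_to R (rem (m + i)%N)).
      under [in RHS]eq_bigr do rewrite scalerBr.
      rewrite sumrB.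
      have -> : \sum_(i < d.+1) q`_i *: (f * 'X^i) = q * f.
        have qE : q = \sum_(i < d.+1) q`_i *: 'X^i.
          by rewrite -[LHS]coefK poly_def szq.
        transitivity ((\sum_(i < d.+1) q`_i *: 'X^i) * f); last by rewrite -qE.
        by rewrite mulr_suml; apply: eq_bigr => i _; rewrite -scalerAl [f * _]mulrC.
      by rewrite -/g mulrBr [q * _%:P]mulrC mul_polyC; ring.
    apply: dvdp_sub.
      rewrite PE; apply: dvdp_mul => //.
      by rewrite dvdp_XsubCl /root !hornerE subrr.
    apply: (big_ind (fun r => P %| r)) => [|x y|i _]; first exact: dvdp0.
      exact: dvdp_add.
    rewrite -mul_polyC; apply: dvdp_mull.
    have [K KE] := remE (m + i)%N.
    have -> : f * 'X^i = intpoly_to R (p^`() * 'X^(m + i)).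
      rewrite /intpoly_to rmorphM /= map_polyXn -/(intpoly_to R p^`()) -dPE.
      by rewrite /f exprD mulrA.
    rewrite KE /intpoly_to rmorphD rmorphM /= addrK.
    exact: dvdp_mull.
  have gE : g = f.[beta] *: q.
    apply/eqP; rewrite -subr_eq0; apply/negPn/negP => g0.
    have := dvdp_leq g0 Pg; rewrite szP leqNgt ltnS.
    apply/negP; rewrite negbK (leq_trans (size_polyD _ _)) // geq_max szg.
    by rewrite size_polyN (leq_trans (size_scale_leq _ _)) // szq.
  have := congr1 (fun r : {poly R} => r`_d) gE; rewrite /= coefZ coef_sum.
  have -> : q`_d = 1 by move: qm; rewrite monicE lead_coefE szq => /eqP.
  rewrite mulr1 => gdE.
  under eq_bigr do rewrite mulrBr.
  rewrite sumrB.
  have -> : \sum_(i < d.+1) q`_i * (T (m + i)%N)%:~R = f.[beta].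
    by rewrite -gdE; apply: eq_bigr => i _; rewrite coefZ coef_intpoly_to.
  rewrite /f hornerM dP hornerXn (horner_coef q) szq mulr_suml -sumrB big1 //.
  by move=> i _; rewrite exprD; ring.
exists d, (fun i => q`_i), T; split => //.
- by move: qm; rewrite monicE lead_coefE szq => /eqP.
- have [s alls sE] := pisot_cofactor_roots rootC PE qb0 qm.
  pose u m : R[i] := real_complex R (beta ^+ m - (T m)%:~R).
  have [|C hC] := @recur_summable _ s u alls.
    move=> m; rewrite -sE /recur size_map_poly szq.
    rewrite -[RHS](rmorph0 (real_complex R)) -(rec m) rmorph_sum.
    by apply: eq_bigr => i _; rewrite coef_map rmorphM.
  exists (complex.Re C) => M.
  have := hC M; rewrite (eq_bigr (fun m : 'I_M => real_complex R `|beta ^+ m - (T m)%:~R|)).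
    by rewrite -rmorph_sum /= lecE => /andP[].
  by move=> m _; rewrite /u normc_def /= expr0n addr0 sqrtr_sqr.
- move=> a; rewrite -horner_intpoly_to => a0 i id.
  case: (eqVneq (\poly_(i < d.+1) a i) 0) => [/(congr1 (fun r : {poly int} => r`_i))|an0].
    by rewrite coef_poly id coef0.
  have := irreducible_root_horner_neq0 irrp rootp an0.
  by rewrite szp ltnS size_poly a0 eqxx => /(_ isT).
Qed.

(** * Fejer kernels *)

Lemma cosD_int2pi (R : realType) (y : R) (n : int) : cos (y + 2 * pi * n%:~R) = cos y.
Proof.
have natc (k : nat) z : cos (z + 2 * pi * k%:R) = cos z :> R.
  by rewrite -(periodicn (@cosD2pi R) k z) -mulr_natl -mulr_natr; congr cos; ring.
case: n => k; first exact: natc.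
rewrite NegzE rmorphN /= mulrN -[in RHS](subrK (2 * pi * k.+1%:R) y).
by rewrite natc.
Qed.

Lemma cos_ge_half (R : realType) :
  exists2 c : R, 0 < c & forall y, `|y| <= c -> 1 / 2 <= cos y.
Proof.
have /cvgrPdist_le/(_ (1 / 2)) := @continuous_cos R 0.
rewrite divr_gt0 // => /(_ isT) /nbhs_ballP[e /= e0 he].
exists (e / 2); first by rewrite divr_gt0.
move=> y ye; have : ball 0 e y.
  rewrite /ball /= sub0r normrN; apply: le_lt_trans ye _.
  by rewrite ltr_pdivrMr // mulr_natr mulr2n ltrDl.
by move=> /he; rewrite cos0 => /ler_normlP[_]; lra.
Qed.

Lemma sqr_sum_cos_sin (R : realType) (I : finType) (f : I -> R) :
  (\sum_a cos (f a)) ^+ 2 + (\sum_a sin (f a)) ^+ 2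
  = \sum_a \sum_a' cos (f a - f a').
Proof.
rewrite !expr2 !mulr_suml -big_split; apply: eq_bigr => a _ /=.
by rewrite !mulr_sumr -big_split; apply: eq_bigr => a' _; rewrite cosB.
Qed.

Section fejer.
Context (R : realType) (d L : nat).
Implicit Types (a : {ffun 'I_d.+1 -> 'I_L}) (theta : 'I_d.+1 -> R).

Definition dotp a theta : R := \sum_i (a i)%:R * theta i.

(** Squared modulus of the sum of [exp (2 i pi a.theta)] over the box [[0, L)^(d+1)]: a product of
    one-dimensional Fejer kernels, not normalised. *)
Definition fejer theta : R :=
  (\sum_a cos (2 * pi * dotp a theta)) ^+ 2
  + (\sum_a sin (2 * pi * dotp a theta)) ^+ 2.

Lemma fejerE theta : fejer theta =
  \sum_a \sum_a' cos (2 * pi * (dotp a theta - dotp a' theta)).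
Proof.
rewrite /fejer sqr_sum_cos_sin; apply: eq_bigr => a _; apply: eq_bigr => a' _.
by congr cos; ring.
Qed.

Lemma fejer_ge0 theta : 0 <= fejer theta.
Proof. by rewrite addr_ge0 // sqr_ge0. Qed.

Lemma card_box : #|{: {ffun 'I_d.+1 -> 'I_L}}| = (L ^ d.+1)%N.
Proof. by rewrite card_ffun !card_ord. Qed.

(** Near an integer point every [a.theta] is close to the integer [a.n], so each of the [L ^ d.+1]
    cosines is at least 1/2; the square of the sines is dropped. *)
Lemma fejer_ge (c eps : R) theta (n : 'I_d.+1 -> int) :
  (forall y, `|y| <= c -> 1 / 2 <= cos y) ->
  (forall i, `|theta i - (n i)%:~R| <= eps) ->
  2 * pi * (d.+1%:R * L%:R * eps) <= c ->
  ((L ^ d.+1)%:R / 2) ^+ 2 <= fejer theta.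
Proof.
move=> hc heps hL; rewrite /fejer -[leLHS]addr0 lerD ?sqr_ge0 //.
suff hS : (L ^ d.+1)%:R / 2 <= \sum_a cos (2 * pi * dotp a theta).
  by rewrite !expr2 ler_pM // divr_ge0.
rewrite -card_box -sum1_card natr_sum mulr_suml; apply: ler_sum => a _.
pose m : int := \sum_i (a i)%:Z * n i.
have -> : cos (2 * pi * dotp a theta) = cos (2 * pi * (dotp a theta - m%:~R)).
  by rewrite -[RHS](cosD_int2pi _ m); congr cos; ring.
apply: hc; rewrite normrM (ger0_norm (mulr_ge0 _ (pi_ge0 R))) //.
apply: le_trans hL; rewrite ler_wpM2l ?mulr_ge0 ?pi_ge0 //.
rewrite /dotp /m rmorph_sum -sumrB.
apply: (le_trans (ler_norm_sum _ _ _)).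
have -> : d.+1%:R * L%:R * eps = \sum_(i < d.+1) L%:R * eps :> R.
  by rewrite sumr_const card_ord -[RHS]mulr_natl mulrA.
apply: ler_sum => i _; rewrite rmorphM /= -mulrBr normrM ler_pM // normr_nat.
by rewrite ler_nat ltnW.
Qed.
End fejer.

(** * Grid points near a hyperplane *)

Section grid.
Context (R : realType) (d N : nat) (b : nat -> R) (C eta : R).

(** The first [d] coordinates run over a mesh of step [eta] from [- C]; the last one is solved from
    the equation of the hyperplane, with last coefficient 1. *)
Definition gridp (j : {ffun 'I_d -> 'I_N}) (i : 'I_d.+1) : R :=
  if unlift ord_max i is Some k then - C + (j k)%:R * eta
  else - \sum_(k < d) b k * (- C + (j k)%:R * eta).

(* The hyperplane orthogonal to [b] is a graph over the first [d] coordinates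
   because [b d = 1], so [N ^ d] points suffice. *)
Lemma grid_near (v : nat -> R) : b d = 1 -> 0 < eta -> N%:R * eta = 2 * C ->
  \sum_(i < d.+1) b i * v i = 0 ->
  (forall i, (i < d.+1)%N -> `|v i| < C) ->
  exists j, forall i : 'I_d.+1, `|v i - gridp j i| <= (1 + \sum_(k < d) `|b k|) * eta.
Proof.
move=> bd eta0 NE bv vC.
have N0 : (0 < N)%N.
  have C0 : 0 < C by apply: le_lt_trans (vC 0%N isT).
  rewrite lt0n; apply/eqP => N0; move: NE; rewrite N0 mul0r => /esym/eqP.
  by rewrite mulf_eq0 pnatr_eq0 /= (gt_eqF C0).
(* The mesh index is the floor of [(v i + C) / eta], which stays below [N] because [v i < C] and
   [N eta = 2 C]. *)
have tr (i : 'I_d) : exists k : 'I_N, `|v i - (- C + k%:R * eta)| <= eta.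
  have /ltr_normlP[v1 v2] := vC i (ltnW (ltn_ord i)).
  have y0 : 0 <= (v i + C) / eta by rewrite divr_ge0 ?ltW //; lra.
  have kN : (Num.truncn ((v i + C) / eta) < N)%N.
    by rewrite truncn_lt_nat // ltr_pdivrMr // NE; lra.
  exists (Ordinal kN) => /=.
  have /andP[] := truncn_itv y0; set k := Num.truncn _.
  rewrite ler_pdivlMr // ltr_pdivrMr // => h1 h2.
  have : (k.+1%:R * eta = k%:R * eta + eta) by rewrite -natr1 mulrDl mul1r.
  by move=> h3; apply/ler_normlP; split; lra.
have [j hj] := choice tr.
exists [ffun i => j i] => i; rewrite /gridp; case: unliftP => [k|] ->.
  rewrite lift_max ffunE (le_trans (hj k)) // mulrDl mul1r lerDl.
  by rewrite mulr_ge0 ?sumr_ge0 // ltW.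
(* For the last coordinate the equation turns the error into the combination of the other errors
   with coefficients [b k]. *)
move: bv; rewrite big_ord_recr /= bd mul1r => /eqP.
rewrite addrC addr_eq0 => /eqP ->.
rewrite opprK addrC -sumrB (le_trans (ler_norm_sum _ _ _)) //.
rewrite mulrDl mul1r; apply: ler_wpDl; first exact: ltW.
rewrite mulr_suml.
apply: ler_sum => k _; rewrite -mulrBr normrM ler_wpM2l // distrC ffunE.
exact: hj.
Qed.

End grid.

(** * The trigonometric majorant *)

Definition digit_poly (R : realType) (beta : R) (x : nat -> int) (k : nat) : R :=
  \sum_(j < k) (x j)%:~R * beta ^+ (k - j.+1).

Definition trigsum (R : realType) (I : finType) (kappa : R) (zeta phi : I -> R) (t : R) :=
  kappa * \sum_i cos (2 * pi * (zeta i * t) + phi i).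

(** Distinct [j] give distinct indices of [r], so the bound is uniform in [k] and [i]; it confines
    the vectors [v] below to one box. *)
Lemma norm_conv_le (R : realType) (r : nat -> R) (x : nat -> int) (D C : R) k i :
  (forall M, \sum_(m < M) `|r m| <= C) -> (forall j, `|(x j)%:~R| <= D) ->
  `|\sum_(j < k) (x j)%:~R * r (k - j.+1 + i)%N| <= D * C.
Proof.
move=> rC xD; have D0 : 0 <= D by apply: le_trans (xD 0%N).
apply: (le_trans (ler_norm_sum _ _ _)).
apply: (@le_trans _ _ (D * \sum_(j < k) `|r (k - j.+1 + i)%N|)).
  by rewrite mulr_sumr; apply: ler_sum => j _; rewrite normrM ler_wpM2r.
rewrite ler_wpM2l // (le_trans _ (rC (i + k)%N)) //.
rewrite (reindex_inj rev_ord_inj) /= big_split_ord /=.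
apply: ler_wpDl; first by apply: sumr_ge0.
apply: ler_sum => j _; rewrite subnSK // subKn; last exact: ltnW.
by rewrite addnC.
Qed.

(** The order of the quantifiers matters: [c] and [C1] depend only on [beta] and [D], and the sum is
    chosen before the digits and [k], so that [k] can go to infinity with [L] fixed. *)
Lemma trig_majorant (R : realType) (beta D : R) : pisot beta -> 0 <= D ->
  exists2 c : R, 0 < c & exists C1 : R, forall (L : nat) (x0 : R), (0 < L)%N ->
  exists (I : finType) (kappa : R) (zeta phi : I -> R),
  [/\ forall i, Zbeta beta (zeta i),
      kappa * \sum_(i | zeta i == 0) cos (phi i) <= C1 / L%:R,
      forall t, 0 <= trigsum kappa zeta phi t &
      forall (x : nat -> int) k (F : R), (forall j, `|(x j)%:~R| <= D) ->
        `|F - x0| <= c / L%:R ->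
        1 <= trigsum kappa zeta phi (digit_poly beta x k + F)].
Proof.
move=> pis D0; have beta1 := pis.1; have beta0 : 0 < beta by apply: lt_trans beta1.
have [d [b [T [bd rec [Cr hCr] indep]]]] := pisot_approx pis.
have [c0 c00 hc0] := cos_ge_half R.
have Cr0 : 0 <= Cr by have := hCr 0%N; rewrite big_ord0.
(* The summand 1 makes the bound on the vectors strict, as [grid_near] asks. *)
pose C := D * Cr + 1.
have C_gt0 : 0 < C by rewrite ltr_wpDl // mulr_ge0.
pose B := 1 + \sum_(k < d) `|b k|.
have B0 : 0 <= B by rewrite addr_ge0 // sumr_ge0.
(* With this [K], the window of half-length [c0 / (K * beta ^+ d) / L] uses half of the tolerance
   [c0] on the phases; [N0] makes the mesh error fit into the other half. *)
pose K : R := 4 * pi * d.+1%:R.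
have K0 : 0 < K by rewrite !mulr_gt0 // pi_gt0.
have bd0 : 0 < beta ^+ d by rewrite exprn_gt0.
pose N0 := (Num.truncn (2 * C * B * K / c0)).+1.
have N0gt : 2 * C * B * K / c0 < N0%:R by exact: truncnS_gt.
have N00 : 0 < N0%:R :> R by rewrite ltr0n.
exists (c0 / (K * beta ^+ d)); first exact: divr_gt0 c00 (mulr_gt0 K0 bd0).
exists (4 * N0%:R ^+ d) => L x0 L0.
have LR0 : 0 < L%:R :> R by rewrite ltr0n.
pose N := (N0 * L)%N; pose eta : R := 2 * C / N%:R.
have NR0 : 0 < N%:R :> R by rewrite ltr0n muln_gt0.
have eta0 : 0 < eta by rewrite divr_gt0 ?mulr_gt0.
have NE : N%:R * eta = 2 * C by rewrite mulrC divfK // gt_eqF.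
pose pw (i : 'I_d.+1) : R := beta ^+ i.
(* Centres of the kernels: [x0 * pw i] accounts for the window, the grid point for the non-integral
   part of [digit_poly beta x k * beta ^+ i]. *)
pose g (j : {ffun 'I_d -> 'I_N}) i : R := x0 * pw i + gridp b C eta j i.
pose box := {ffun 'I_d.+1 -> 'I_L}.
(* An index stands for one cosine of one expanded kernel: a centre and a pair of box points. *)
pose I := ({ffun 'I_d -> 'I_N} * (box * box))%type.
pose z (i : I) : R := dotp i.2.1 pw - dotp i.2.2 pw.
pose ph (i : I) : R := - (2 * pi * (dotp i.2.1 (g i.1) - dotp i.2.2 (g i.1))).
pose kappa : R := ((L ^ d.+1)%:R / 2) ^- 2.
have Ld0 : 0 < (L ^ d.+1)%:R :> R by rewrite ltr0n expn_gt0 L0.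
have kappa0 : 0 < kappa by rewrite invr_gt0 exprn_gt0 // divr_gt0.
have dotpB (a : box) t h : dotp a (fun i => t * pw i - h i) = t * dotp a pw - dotp a h.
  by rewrite /dotp mulr_sumr -sumrB; apply: eq_bigr => i _; ring.
have trigE t : trigsum kappa z ph t =
    kappa * \sum_j @fejer _ _ L (fun i => t * pw i - g j i).
  rewrite /trigsum; congr (_ * _).
  rewrite -(pair_bigA _ (fun j p => cos (2 * pi * (z (j, p) * t) + ph (j, p)))) /=.
  apply: eq_bigr => j _.
  rewrite -(pair_bigA _ (fun a a' => cos (2 * pi * (z (j, (a, a')) * t) + ph (j, (a, a'))))) /=.
  rewrite fejerE; apply: eq_bigr => a _; apply: eq_bigr => a' _.
  by rewrite !dotpB /z /ph /=; congr cos; ring.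
have zE (a a' : box) : dotp a pw - dotp a' pw =
    \sum_(i < d.+1) ((a i)%:Z - (a' i)%:Z)%:~R * beta ^+ i.
  by rewrite /dotp -sumrB; apply: eq_bigr => i _; rewrite rmorphB /= mulrBl.
pose co (a a' : box) (i : nat) : int := (a (inord i))%:Z - (a' (inord i))%:Z.
have zE' (a a' : box) : dotp a pw - dotp a' pw =
    \sum_(i < d.+1) (co a a' i)%:~R * beta ^+ i.
  by rewrite zE; apply: eq_bigr => i _; rewrite /co inord_val.
exists I, kappa, z, ph; split.
- move=> [j [a a']]; rewrite /Zbeta /z /=.
  by exists (\poly_(i < d.+1) co a a' i); rewrite horner_intpoly_to zE'.
(* Independence of the powers of [beta] forces [a = a'] at frequency 0. *)
- have card_diag : (#|[pred i | z i == 0%R]| <= N ^ d * L ^ d.+1)%N.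
    pose f (p : {ffun 'I_d -> 'I_N} * box) : I := (p.1, (p.2, p.2)).
    have -> : (N ^ d * L ^ d.+1 = #|[set: {ffun 'I_d -> 'I_N} * box]%SET|)%N.
      by rewrite cardsT card_prod !card_ffun !card_ord.
    apply: leq_trans (leq_imset_card f _); apply: subset_leq_card.
    apply/fintype.subsetP => -[j [a a']]; rewrite inE /z /= zE' => /eqP /indep h.
    apply/imsetP; exists (j, a); rewrite ?inE // /f /=; congr (_, (_, _)).
    apply/ffunP => i; apply/val_inj/esym.
    have := h i (ltn_ord i); rewrite /co inord_val => /eqP.
    by rewrite subr_eq0 => /eqP[].
  apply: (@le_trans _ _ (kappa * (N ^ d * L ^ d.+1)%:R)).
    apply: ler_wpM2l; first exact: ltW.
    apply: (@le_trans _ _ (\sum_(i | z i == 0) 1)); first by apply: ler_sum => i _; exact: cos_le1.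
    by rewrite sumr_const ler_nat.
  (* The bound is [4 N^d L^(d+1) / L^(2d+2)], which is [4 N0^d / L] since [N = N0 L]. *)
  rewrite /kappa /N expnMn expnS !natrM !natrX le_eqVlt; apply/orP; left; apply/eqP.
  by field; rewrite !gt_eqF // exprn_gt0.
- by move=> t; rewrite trigE mulr_ge0 ?(ltW kappa0) // sumr_ge0 // => j _; exact: fejer_ge0.
- move=> x k F xD hF; rewrite trigE.
  pose r m := beta ^+ m - (T m)%:~R.
  pose v i := \sum_(j < k) (x j)%:~R * r (k - j.+1 + i)%N.
  pose n i : int := \sum_(j < k) x j * T (k - j.+1 + i)%N.
  have vC i : `|v i| < C.
    by apply: le_lt_trans (norm_conv_le _ _ hCr xD) _; rewrite /C ltrDl.
  have bv : \sum_(i < d.+1) b i * v i = 0.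
    under eq_bigr do rewrite mulr_sumr.
    rewrite exchange_big big1 // => j _.
    under eq_bigr do rewrite mulrCA.
    by rewrite -mulr_sumr rec mulr0.
  (* [digit_poly beta x k] is the Y_k of the overview; writing each power of [beta] as [T m + r m]
     splits its multiples into an integer and the bounded [v i]. *)
  have YE i : digit_poly beta x k * beta ^+ i = v i + (n i)%:~R.
    rewrite /digit_poly /v /n rmorph_sum mulr_suml -big_split; apply: eq_bigr => j _.
    by rewrite rmorphM /= /r exprD; ring.
  have [j hj] := grid_near bd eta0 NE bv (fun i _ => vC i).
  (* The kernel centred at the nearby grid point already reaches 1; the others are nonnegative. *)
  rewrite (bigD1 j) //= mulrDr.
  apply: ler_wpDr.
    by rewrite mulr_ge0 ?(ltW kappa0) // sumr_ge0 // => l _; exact: fejer_ge0.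
  rewrite /kappa mulrC ler_pdivlMr ?mul1r ?exprn_gt0 ?divr_gt0 //.
  apply: (@fejer_ge _ _ _ c0 (c0 / (K * beta ^+ d) / L%:R * beta ^+ d + B * eta) _
    (fun i => n i)) => //.
    move=> i; rewrite /g /pw mulrDl YE.
    rewrite (_ : _ - _ = (F - x0) * beta ^+ i + (v i - gridp b C eta j i)); last by ring.
    apply: (le_trans (ler_normD _ _)); apply: lerD; last exact: hj.
    rewrite normrM; apply: ler_pM => //; rewrite ger0_norm ?exprn_ge0 ?(ltW beta0) //.
    by rewrite ler_weXn2l ?(ltW beta1) // -ltnS.
  have -> : 2 * pi * (d.+1%:R * L%:R * (c0 / (K * beta ^+ d) / L%:R * beta ^+ d + B * eta))
      = c0 / 2 + (2 * C * B * K / c0) / N0%:R * c0 / 2.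
    rewrite /eta /N natrM /K; move: (lt0r_neq0 (pi_gt0 R)); move: (@pi R) => P P0.
    field; rewrite P0 !(lt0r_neq0 c00, lt0r_neq0 bd0, lt0r_neq0 LR0, lt0r_neq0 N00).
    by rewrite /= nat1r pnatr_eq0.
  have : (2 * C * B * K / c0) / N0%:R <= 1 by rewrite ler_pdivrMr // mul1r ltW.
  by rewrite -(ler_pM2r c00) mul1r => h; lra.
Qed.

(** * Shift invariance *)

(** [limn] takes the default value [point] where the sequence diverges. The convergence set is
    measurable by the Cauchy criterion, and the sequence replaced by [point] off that set converges
    everywhere to the same function. *)
Lemma measurable_fun_limn d (T : measurableType d) (R : realType) (h : nat -> T -> R) :
  (forall n, measurable_fun setT (h n)) ->
  measurable_fun setT (fun x => limn (h ^~ x)).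
Proof.
move=> mh.
pose C := \bigcap_m \bigcup_N \bigcap_(i in [set i | (N <= i)%N])
  [set x | `|h i x - h N x| <= m.+1%:R^-1].
have mC : measurable C.
  apply: bigcapT_measurable => m; apply: bigcupT_measurable => N.
  apply: bigcap_measurable; first by exists N => /=.
  move=> i _.
  have mf : measurable_fun setT (fun x => `|h i x - h N x|).
    by apply: measurableT_comp => //; exact: measurable_funB.
  rewrite (_ : [set x | _] = (fun x => `|h i x - h N x|) @^-1` `]-oo, m.+1%:R^-1]%classic).
    by rewrite -[X in measurable X]setTI; exact: mf.
  by apply/seteqP; split=> x; rewrite /= in_itv.
have CP x : C x <-> cvgn (h ^~ x).
  split.
    move=> Cx; apply/cauchy_cvgP/cauchy_exP => e e0.
    have [m _ hm] := near_infty_natSinv_lt (PosNum e0).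
    have [N _ hN] := Cx m I.
    exists (h N x); exists N => // i /= Ni.
    rewrite /ball /= distrC.
    by apply: le_lt_trans (hN i Ni) _; exact: (hm m (leqnn m)).
  move=> /cvg_ex[l hl] m _.
  have e0 : 0 < (m.+1%:R^-1 / 2 : R) by rewrite divr_gt0 ?invr_gt0.
  have /cvgrPdist_le/(_ _ e0)[N _ hN] := hl.
  exists N => // i /= Ni.
  rewrite (_ : h i x - h N x = (l - h N x) - (l - h i x)); last by ring.
  rewrite (le_trans (ler_normB _ _)) // [leRHS](splitr m.+1%:R^-1) lerD //.
    exact: (hN N (leqnn N)).
  exact: (hN i Ni).
apply: (@measurable_fun_cvg _ _ _ _ (fun n x => if x \in C then h n x else point)).
  move=> n; apply: measurable_fun_ifT => //.
  by apply: (measurable_fun_bool true); rewrite setTI (_ : _ @^-1` _ = C) //;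
    apply/seteqP; split => x; [exact: set_mem|exact: mem_set].
move=> x _; have [xC|/negP xC] := boolP (x \in C).
  exact/CP/set_mem.
by rewrite dvgP => [|/CP /mem_set //]; exact: cvg_cst.
Qed.

Lemma measurable_cylinder w : measurable (cylinder w : set seqspace).
Proof. by apply: sub_sigma_algebra; exists w. Qed.

(** A condition on coordinate [k] is a union of cylinders over words of length [k.+1], and integer
    words are countable. *)
Lemma measurable_coord_set (S : set int) k : measurable ([set x | S (x k)] : set seqspace).
Proof.
rewrite (_ : [set x | _] = \bigcup_(w : seq int)
    if `[< size w = k.+1 /\ S (nth 0 w k) >] then cylinder w else set0).
  apply: countable_bigcupT_measurable; first exact: countableP.
  by move=> w; case: ifPn => // _; exact: measurable_cylinder.
apply/seteqP; split=> x /=.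
  move=> Sx; exists (mkseq x k.+1) => //.
  rewrite ifT; first by move=> i; rewrite size_mkseq => ik; rewrite nth_mkseq.
  by apply/asboolP; rewrite size_mkseq nth_mkseq.
by move=> [w _]; case: ifPn => // /asboolP[sw Sw] xw; rewrite xw ?sw.
Qed.

Lemma measurable_coord (R : realType) (f : int -> R) k :
  measurable_fun setT (fun x : seqspace => f (x k)).
Proof.
move=> _ B mB; rewrite setTI; exact: (measurable_coord_set (f @^-1` B) k).
Qed.

Lemma measurable_phiplus (R : realType) (beta : R) :
  measurable_fun setT (phiplus beta : seqspace -> R).
Proof.
apply: measurable_fun_limn => n; apply: measurable_sum => k.
exact: (measurable_coord (fun a => a%:~R / beta ^+ k.+1)).
Qed.

Definition seqshift (k : nat) (x : seqspace) : seqspace := fun i => x (k + i)%N.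

Lemma measurable_seqshift k : measurable_fun setT (seqshift k).
Proof.
apply: (@measurability _ _ seqspace seqspace setT (seqshift k) cylinders) => //.
move=> _ [_ [w _ <-] <-]; rewrite setTI.
rewrite (_ : _ @^-1` _ = \bigcap_i
    [set x : seqspace | [set a | (i < size w)%N -> a = nth 0 w i] (x (k + i)%N)]).
  by apply: bigcapT_measurable => i; exact: measurable_coord_set.
by apply/seteqP; split=> x h i //=; [move=> _; exact: h|exact: h].
Qed.

Lemma cylinder_nil : cylinder [::] = setT.
Proof. by apply/seteqP; split=> x //= _ k. Qed.

Lemma cylinder_cons a w :
  cylinder (a :: w) = [set x | x 0%N = a] `&` seqshift 1 @^-1` cylinder w.
Proof.
apply/seteqP; split=> x /=.
  by move=> h; split=> [|k kw]; [exact: (h 0%N isT)|exact: (h k.+1 kw)].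
by move=> [x0 h] [|k] // kw; exact: (h k kw).
Qed.

(** Two cylinders are nested or disjoint; the empty set is added for the second case. *)
Lemma cylinder_setI_closed : setI_closed [set C | C = set0 \/ cylinders C].
Proof.
have le_case w w' : (size w <= size w')%N ->
    cylinder w `&` cylinder w' = set0 \/ cylinders (cylinder w `&` cylinder w').
  move=> ww'; case: (pselect (forall k, (k < size w)%N -> nth 0 w k = nth 0 w' k)) => h.
    right; exists w' => //; apply/seteqP; split=> [x hx|x []//]; split=> // k kw.
    by rewrite h // hx // (leq_trans kw).
  left; apply/seteqP; split=> // x [hx hx']; apply: h => k kw.
  by rewrite -hx // hx' // (leq_trans kw).
move=> C C' [->|[w _ <-]] [->|[w' _ <-]]; rewrite ?set0I ?setI0; try by left.
case/orP: (leq_total (size w) (size w')) => h; first exact: le_case.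
by rewrite setIC; exact: le_case.
Qed.

Lemma cylinder_measure_unique (R : realType) (m1 m2 : {measure set seqspace -> \bar R}) :
  (m1 setT < +oo)%E -> (forall w, m1 (cylinder w) = m2 (cylinder w)) ->
  forall S, measurable S -> m1 S = m2 S.
Proof.
move=> m1oo m12.
pose G : set (set seqspace) := [set C | C = set0 \/ cylinders C].
move=> S mS; apply: (@measure_unique _ R seqspace G (fun=> setT)) => //.
- apply/seteqP; split; last first.
    apply: smallest_sub; first exact: smallest_sigma_algebra.
    by move=> C [->|[w _ <-]]; [exact: (@measurable0 _ seqspace)|exact: measurable_cylinder].
  apply: smallest_sub; first exact: smallest_sigma_algebra.
  by move=> C CC; apply: sub_sigma_algebra; right.
- exact: cylinder_setI_closed.
- by move=> _; right; exists [::] => //; rewrite cylinder_nil.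
- by rewrite bigcup_const.
- by move=> C [->|[w _ <-]]; rewrite ?measure0.
Qed.

Lemma measurable_preimage_seqshift k (S : set seqspace) :
  measurable S -> measurable (seqshift k @^-1` S).
Proof. by move=> mS; rewrite -[X in measurable X]setTI; exact: measurable_seqshift. Qed.

Section invariance.
Context (R : realType) (A : seq int) (mu : probability seqspace R).
Hypothesis uA : uniq A.
Hypothesis mu_sum : forall w, (mu (cylinder w) = \sum_(a <- A) mu (cylinder (a :: w)))%E.

Let at0 a : set seqspace := [set x | x 0%N = a].

Lemma measurable_at0 a : measurable (at0 a).
Proof. exact: (measurable_coord_set [set a]). Qed.

Lemma measure_head_in (s : seq int) (S : set seqspace) : uniq s -> measurable S ->
  (mu (S `&` [set x | x 0%N \in s]) = \sum_(a <- s) mu (at0 a `&` S))%E.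
Proof.
move=> + mS; elim: s => [|a s IH] /=.
  move=> _; rewrite big_nil (_ : _ `&` _ = set0) ?measure0 //.
  by apply/seteqP; split=> x [].
move=> /andP[aNs us]; rewrite big_cons -IH //.
rewrite (_ : _ `&` _ = (at0 a `&` S) `|` (S `&` [set x | x 0%N \in s])); last first.
  apply/seteqP; split=> x /=; rewrite inE.
    by move=> [Sx /orP[/eqP|]]; [left|right].
  by move=> [[-> Sx]|[Sx ->]]; rewrite ?eqxx ?orbT.
apply: measureU.
- by apply: measurableI => //; exact: measurable_at0.
- apply: measurableI => //; exact: (measurable_coord_set [set a | a \in s]).
- by apply/seteqP; split=> x //= [[x0 _] [_]]; rewrite x0 (negbTE aNs).
Qed.

(** For the empty word, [mu_sum] says that the first letter lies in [A] with probability 1. *)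
Lemma measure_head_notin : mu [set x | x 0%N \notin A] = 0%E.
Proof.
have mA : measurable ([set x | x 0%N \in A] : set seqspace).
  exact: (measurable_coord_set [set a | a \in A]).
have := @probability_setC _ _ _ mu _ mA.
have -> : ~` [set x : seqspace | x 0%N \in A] = [set x | x 0%N \notin A].
  by apply/seteqP; split=> x /= /negP.
move=> ->; have := measure_head_in uA (@measurableT _ seqspace).
rewrite setTI => ->.
under eq_bigr do rewrite setIT.
have := mu_sum [::]; rewrite cylinder_nil probability_setT => h.
rewrite [X in (_ - X)%E](_ : _ = 1%E) ?subee //.
rewrite h; apply: eq_bigr => a _; congr (mu _).
by rewrite cylinder_cons cylinder_nil preimage_setT setIT.
Qed.

Lemma measure_head (S : set seqspace) : measurable S ->
  (mu S = \sum_(a <- A) mu (at0 a `&` S))%E.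
Proof.
move=> mS; rewrite -measure_head_in //.
have mA : measurable ([set x | x 0%N \in A] : set seqspace).
  exact: (measurable_coord_set [set a | a \in A]).
rewrite -[in LHS](setUIDK S [set x | x 0%N \in A]) measureU; last 1 first.
- by apply/seteqP; split=> x //= [[_ ?] [_ ?]].
- rewrite [X in (_ + X)%E](_ : _ = 0%E) ?adde0 //.
  apply: (@subset_measure0 _ _ _ mu _ [set x | x 0%N \notin A]).
  + exact: measurableD.
  + exact: (measurable_coord_set [set a | a \notin A]).
  + by move=> x [_ /negP].
  + exact: measure_head_notin.
- exact: measurableI.
- exact: measurableD.
Qed.

(** It suffices to compare on cylinders: up to a null set the preimage of [cylinder w] splits by
    first letter into the [cylinder (a :: w)], whose masses add up by [mu_sum]. *)
Lemma shift1_invariant (S : set seqspace) : measurable S -> mu (seqshift 1 @^-1` S) = mu S.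
Proof.
apply: (@cylinder_measure_unique _ (pushforward mu (seqshift 1)) mu).
- exact: measurable_seqshift.
- by move=> ?; rewrite [X in (X < _)%E](_ : _ = mu setT) // probability_setT ltry.
- move=> ? w; rewrite /= /pushforward measure_head; last first.
    by apply: measurable_preimage_seqshift; exact: measurable_cylinder.
  by rewrite mu_sum; apply: eq_bigr => a _; rewrite cylinder_cons.
Qed.

Lemma shift_invariant k (S : set seqspace) : measurable S -> mu (seqshift k @^-1` S) = mu S.
Proof.
elim: k S => [|k IH] S mS.
  by rewrite (_ : seqshift 0 @^-1` S = S).
rewrite -(shift1_invariant mS) -(IH _ (measurable_preimage_seqshift 1 mS)).
rewrite -comp_preimage (_ : seqshift 1 \o seqshift k = seqshift k.+1) //.
by apply/funext => x; apply/funext => i; rewrite /seqshift /= addnA addn1.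
Qed.

(** The underlying space consists of all integer sequences; off this null set the digits are bounded
    and, for [beta > 1], the series of [phiplus] converges. *)
Lemma measure_coord_notin : mu [set x | exists k, x k \notin A] = 0%E.
Proof.
have m0 k : mu [set x | x k \notin A] = 0%E.
  rewrite -measure_head_notin -[RHS](shift_invariant k).
    by congr (mu _); apply/funext => x; rewrite /preimage /seqshift /= addn0.
  exact: (measurable_coord_set [set a | a \notin A]).
have -> : [set x : seqspace | exists k, x k \notin A] = \bigcup_k [set x | x k \notin A].
  by apply/seteqP; split=> [x [k xk]|x [k _ xk]]; exists k.
have mk k : measurable ([set x | x k \notin A] : set seqspace).
  exact: (measurable_coord_set [set a | a \notin A]).
apply/negligibleP; first exact: bigcupT_measurable.
by apply: negligible_bigcup => k; apply/negligibleP; [exact: mk|exact: m0].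
Qed.

End invariance.

(** The matrices [labmx] of the letters add up to the adjacency matrix, which acts on [vL] as
    [lambda]; this cancels the extra power of [lambda]. *)
Lemma cylinder_transfer (R : realType) (n : nat) (A : seq int) (E : rel 'I_n.+1)
    (ell : 'I_n.+1 -> 'I_n.+1 -> int) (lambda : R) (vL vR : 'cV[R]_n.+1)
    (mu : set seqspace -> \bar R) :
  0 < lambda -> vL^T *m adjmx R A E ell = lambda *: vL^T ->
  (forall w : seq int,
     mu (cylinder w) =
     (lambda ^- size w *
        (vL^T *m (\prod_(a <- w) labmx R E ell a) *m vR) 0 0)%:E) ->
  forall w, (mu (cylinder w) = \sum_(a <- A) mu (cylinder (a :: w)))%E.
Proof.
move=> l0 hL hmu w; rewrite hmu.
under [in RHS]eq_bigr do rewrite hmu big_cons /=.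
rewrite sumEFin; congr EFin.
rewrite -mulr_sumr -summxE -mulmx_suml.
have vLA (M N : 'M[R]_n.+1) : vL^T *m (M * N) = vL^T *m M *m N.
  by rewrite -mulmxA.
rewrite [in RHS](eq_bigr (fun a => vL^T *m labmx R E ell a *m \prod_(b <- w) labmx R E ell b));
  last by move=> a _; exact: vLA.
rewrite -mulmx_suml -mulmx_sumr -/(adjmx R A E ell) hL -!scalemxAl [in RHS]mxE.
by rewrite exprS invfM mulrACA mulVf ?gt_eqF // mul1r.
Qed.

(** * The interval bound *)

Lemma cvg_phiplus_sum (R : realType) (beta D : R) (x : nat -> int) : 1 < beta ->
  (forall j, `|(x j)%:~R| <= D) ->
  (fun N => \sum_(k < N) ((x k)%:~R / beta ^+ k.+1)) @ \oo --> phiplus beta x.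
Proof.
move=> beta1 xD; have beta0 : 0 < beta by apply: lt_trans beta1.
have D0 : 0 <= D by apply: le_trans (xD 0%N).
suff : cvgn (series (fun k => (x k)%:~R / beta ^+ k.+1 : R^o)).
  rewrite (_ : series _ = fun N => \sum_(k < N) ((x k)%:~R / beta ^+ k.+1)) //.
  by apply/funext => N; rewrite /series /= big_mkord.
apply: (@normed_cvg R R^o).
apply: (@series_le_cvg _ _ (geometric (D / beta) beta^-1)) => [k|k|k|].
- exact: normr_ge0.
- apply: mulr_ge0; first exact: divr_ge0 (ltW beta0).
  by apply: exprn_ge0; rewrite invr_ge0 ltW.
- rewrite /geometric /= normrM normfV (ger0_norm (exprn_ge0 _ (ltW beta0))).
  rewrite exprVn -mulrA -invfM -exprS; apply: ler_wpM2r => //.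
  by rewrite invr_ge0; exact: exprn_ge0 (ltW beta0).
- by apply: is_cvg_geometric_series; rewrite normfV gtr0_norm // invf_lt1.
Qed.

Lemma phiplus_split (R : realType) (beta D : R) (x : nat -> int) k : 1 < beta ->
  (forall j, `|(x j)%:~R| <= D) ->
  beta ^+ k * phiplus beta x = digit_poly beta x k + phiplus beta (seqshift k x).
Proof.
move=> beta1 xD; have beta0 : beta != 0 by rewrite gt_eqF // (lt_trans _ beta1).
have := cvg_phiplus_sum beta1 (fun j => xD (k + j)%N).
have := cvg_phiplus_sum beta1 xD; rewrite -(cvg_shiftn k) => hx hs.
apply: (@cvg_unique _ (@norm_hausdorff _ R^o) (fmap (fun N => beta ^+ k *
    \sum_(j < N + k) ((x j)%:~R / beta ^+ j.+1)) \oo)).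
  by apply: cvgM; [exact: cvg_cst|exact: hx].
rewrite (_ : (fun N => _) = fun N => digit_poly beta x k +
    \sum_(j < N) ((seqshift k x j)%:~R / beta ^+ j.+1)); last first.
  apply/funext => N; rewrite addnC big_split_ord mulrDr /=; congr (_ + _).
    rewrite mulr_sumr; apply: eq_bigr => j _.
    by rewrite mulrCA -expfB_cond ?(negPf beta0) // ltn_ord.
  rewrite mulr_sumr; apply: eq_bigr => j _.
  rewrite /seqshift mulrCA -addnS exprD invfM; congr (_ * _).
  by rewrite mulrA divff ?mul1r // expf_neq0.
by apply: cvgD; [exact: cvg_cst|exact: hs].
Qed.

(** * Integrals of trigonometric sums and their limits *)

Lemma bounded_integrable d (T : measurableType d) (R : realType)
    (nu : {measure set T -> \bar R}) (f : T -> R) (M : R) :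
  (nu setT < +oo)%E -> measurable_fun setT f -> (forall x, `|f x| <= M) ->
  nu.-integrable setT (EFin \o f).
Proof.
move=> nuoo mf fM; apply: measurable_bounded_integrable => //.
exists M; split; first exact: num_real.
by move=> M' MM' x _; rewrite /= (le_trans (fM x)) // ltW.
Qed.

Lemma measurable_cos_affine (R : realType) (a b : R) :
  measurable_fun setT (fun s : measurableTypeR R => cos (a * s + b)).
Proof.
apply: continuous_measurable_fun => s.
apply: (continuous_comp (f := fun s => a * s + b)); last exact: continuous_cos.
by apply: cvgD; [apply: cvgM; [exact: cvg_cst|exact: cvg_id]|exact: cvg_cst].
Qed.

Lemma integrable_cos_affine (R : realType)
    (nu : {measure set (measurableTypeR R) -> \bar R}) (a b : R) :
  (nu setT < +oo)%E -> nu.-integrable setT (EFin \o (fun s => cos (a * s + b))).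
Proof.
move=> nuoo; apply: (@bounded_integrable _ _ _ _ _ 1) => //.
  exact: measurable_cos_affine.
by move=> x; rewrite ler_norml cos_geN1 cos_le1.
Qed.

Lemma Rintegral_sum d (T : measurableType d) (R : realType)
    (nu : {measure set T -> \bar R}) (I : Type) (s : seq I) (f : I -> T -> R) :
  (forall i, nu.-integrable setT (EFin \o f i)) ->
  nu.-integrable setT (EFin \o (fun x => \sum_(i <- s) f i x)) /\
  \int[nu]_x (\sum_(i <- s) f i x) = \sum_(i <- s) \int[nu]_x f i x.
Proof.
move=> intf; elim: s => [|i s [IHi IH]].
  rewrite (_ : (fun x => _) = cst 0); last by apply/funext => x; rewrite big_nil.
  rewrite big_nil; split; first exact: integrable0.
  by rewrite /Rintegral integral0_eq.
rewrite (_ : (fun x => _) = fun x => f i x + \sum_(j <- s) f j x); last first.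
  by apply/funext => x; rewrite big_cons.
rewrite big_cons; split; last by rewrite RintegralD // IH.
by rewrite (_ : EFin \o _ = (EFin \o f i) \+ (EFin \o (fun x => (\sum_(j <- s) f j x)%R)))%E //;
  exact: integrableD.
Qed.

Section trigsum_limit.
Context (R : realType) (beta : R) (nu : {measure set (measurableTypeR R) -> \bar R}).
Hypothesis nu1 : nu setT = 1%E.
Hypothesis hF : forall z, Zbeta beta z -> z != 0 ->
  (fun k : nat => Normc.normc (fourier nu (z * beta ^+ k))) @ \oo --> 0.

Let nuoo : (nu setT < +oo)%E.
Proof. by rewrite nu1 ltry. Qed.

(** A cosine with a phase integrates to a combination of the real and imaginary parts of [fourier],
    each bounded by the modulus; at frequency 0 the integrand is the constant [cos phi] and [nu] has
    mass 1. *)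
Lemma cos_phase_limit (z phi : R) : Zbeta beta z ->
  (fun k => \int[nu]_s cos (2 * pi * (z * (beta ^+ k * s)) + phi)) @ \oo -->
  (if z == 0 then cos phi else 0).
Proof.
move=> zZ; case: eqP => [->|/eqP z0].
  rewrite (_ : (fun k => _) = cst (cos phi)); first exact: cvg_cst.
  apply/funext => k; under eq_Rintegral do rewrite mul0r mulr0 add0r.
  rewrite Rintegral_cst // nu1 mulr1 //.
pose u k := fourier nu (z * beta ^+ k).
have hu : (fun k => Normc.normc (u k)) @ \oo --> 0 by exact: hF.
have hRe : (fun k => complex.Re (u k)) @ \oo --> 0.
  apply/norm_cvg0P; apply: (squeeze_cvgr _ (cvg_cst 0) hu).
  apply: nearW => k; rewrite normr_ge0 /=; case: (u k) => a b /=.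
  by rewrite -sqrtr_sqr ler_sqrt ?addr_ge0 ?sqr_ge0 // lerDl sqr_ge0.
have hIm : (fun k => complex.Im (u k)) @ \oo --> 0.
  apply/norm_cvg0P; apply: (squeeze_cvgr _ (cvg_cst 0) hu).
  apply: nearW => k; rewrite normr_ge0 /=; case: (u k) => a b /=.
  by rewrite -sqrtr_sqr ler_sqrt ?addr_ge0 ?sqr_ge0 // lerDr sqr_ge0.
rewrite (_ : (fun k => _) = fun k => cos phi * complex.Re (u k) + sin phi * complex.Im (u k)).
  rewrite -[X in _ --> X]addr0 -[X in _ --> X + _](mulr0 (cos phi)).
  rewrite -[X in _ --> _ + X](mulr0 (sin phi)).
  by apply: cvgD; apply: cvgM => //; exact: cvg_cst.
apply/funext => k; rewrite /u /fourier /=.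
pose t := z * beta ^+ k.
have ci : nu.-integrable setT (EFin \o (fun s => cos (2 * pi * s * t))).
  rewrite (_ : (fun s => _) = fun s => cos (2 * pi * t * s + 0)).
    exact: integrable_cos_affine.
  by apply/funext => s; congr cos; ring.
have si : nu.-integrable setT (EFin \o (fun s => sin (2 * pi * s * t))).
  rewrite (_ : (fun s => _) = fun s => cos (2 * pi * t * s + (- (pi / 2)))).
    exact: integrable_cos_affine.
  by apply/funext => s; rewrite cosBpihalf; congr sin; ring.
rewrite mulrN -RintegralZl // -RintegralZl //.
rewrite -RintegralB //; [|exact: integrableZl ci|exact: integrableZl si].
apply: eq_Rintegral => s _.
rewrite (_ : 2 * pi * (z * (beta ^+ k * s)) = 2 * pi * s * t); last by rewrite /t; ring.
by rewrite cosD mulrC [sin _ * _]mulrC.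
Qed.

Lemma integrable_trigsum (I : finType) (kappa : R) (zeta phi : I -> R) (a : R) :
  nu.-integrable setT (EFin \o (fun s => trigsum kappa zeta phi (a * s))) /\
  \int[nu]_s trigsum kappa zeta phi (a * s) =
  kappa * \sum_i \int[nu]_s cos (2 * pi * (zeta i * (a * s)) + phi i).
Proof.
have ci i : nu.-integrable setT (EFin \o (fun s => cos (2 * pi * (zeta i * (a * s)) + phi i))).
  rewrite (_ : (fun s => _) = fun s => cos (2 * pi * zeta i * a * s + phi i)).
    exact: integrable_cos_affine.
  by apply/funext => s; congr cos; ring.
have [si sE] := Rintegral_sum (index_enum I) ci.
by split; [exact: integrableZl si|rewrite RintegralZl // sE].
Qed.

(** Only the terms of frequency 0 survive, so the limit is the mean of the trigonometric sum. *)
Lemma trigsum_limit (I : finType) (kappa : R) (zeta phi : I -> R) :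
  (forall i, Zbeta beta (zeta i)) ->
  (fun k => \int[nu]_s trigsum kappa zeta phi (beta ^+ k * s)) @ \oo -->
  kappa * \sum_(i | zeta i == 0) cos (phi i).
Proof.
move=> zZ.
rewrite (_ : (fun k => _) = fun k => kappa *
    \sum_i \int[nu]_s cos (2 * pi * (zeta i * (beta ^+ k * s)) + phi i)); last first.
  by apply/funext => k; rewrite (integrable_trigsum kappa zeta phi (beta ^+ k)).2.
apply: cvgM; first exact: cvg_cst.
rewrite [X in _ --> X]big_mkcond /=.
by apply: cvg_big => [|i _]; [exact: add_continuous|exact: cos_phase_limit].
Qed.

End trigsum_limit.

(** Lebesgue measure is built as an outer measure from [wlength], so a null set has covers by
    half-open intervals of arbitrarily small total length; the bound passes to [nu] by countable
    subadditivity. *)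
Lemma null_dominates_of_interval_bound (R : realType)
    (nu : {measure set (measurableTypeR R) -> \bar R}) (C : R) : 0 <= C ->
  (forall a b : R, a < b -> (nu `]a, b]%classic <= (C * (b - a))%:E)%E) ->
  nu `<< lebesgue_measure.
Proof.
move=> C0 nuC; apply/null_content_dominatesP => B mB B0.
apply/eqP; rewrite eq_le measure_ge0 andbT; apply/lee_addgt0Pr => e e0.
rewrite add0e.
have B0' : mu_ext (@wlength R idfun) B = 0%E by exact: B0.
(* Dividing by [C + 1] instead of [C] allows [C = 0]. *)
have C1 : 0 < C + 1 by rewrite ltr_wpDl.
have e0' : 0 < e / (C + 1) by rewrite divr_gt0.
have fin : mu_ext (@wlength R idfun) B \is a fin_num by rewrite B0'.
have [_ [F [mF BF] <-]] := lb_ereal_inf_adherent e0' fin.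
rewrite -/(mu_ext (@wlength R idfun) B) B0' add0e => Fe.
have mF' k : measurable (F k : set (measurableTypeR R)).
  by apply: sub_sigma_algebra; exact: mF.
have FC k : (nu (F k) <= C%:E * wlength idfun (F k))%E.
  case: (mF k) => -[a b] _ /= <-.
  have [ab|ba] := ltP a b.
    by rewrite wlength_itv /= lte_fin ab -EFinB -EFinM; exact: nuC.
  by rewrite set_itv_ge ?bnd_simp -?leNgt // measure0 wlength0 mule0.
have w0 k : (0 <= wlength idfun (F k))%E by exact: wlength_ge0.
apply: (@le_trans _ _ (\sum_(k <oo) nu (F k))%E).
  apply: measure_sigma_subadditive => //.
apply: (@le_trans _ _ (\sum_(k <oo) (C%:E * wlength idfun (F k)))%E).
  by apply: lee_nneseries => // k _ ; exact: measure_ge0.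
rewrite nneseriesZl //.
apply: (@le_trans _ _ (C%:E * (e / (C + 1))%:E)%E).
  by apply: lee_wpmul2l; rewrite ?lee_fin // ltW.
by rewrite -EFinM lee_fin mulrCA -[leRHS]mulr1 ler_wpM2l ?ler_pdivrMr ?mul1r ?(ltW e0) // lerDl.
Qed.

Lemma int_seq_bound (R : realType) (A : seq int) :
  exists2 D : R, 0 <= D & forall a, a \in A -> `|a%:~R| <= D.
Proof.
exists (\sum_(a <- A) `|a%:~R|); first exact: sumr_ge0.
move=> a aA; rewrite (big_rem a) //= lerDl; exact: sumr_ge0.
Qed.

(** * The bound for [nu] on intervals *)

Section interval_bound.
Context (R : realType) (A : seq int) (beta : R) (mu : probability seqspace R)
  (nu : {measure set (measurableTypeR R) -> \bar R}).
Hypothesis uA : uniq A.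
Hypothesis mu_sum : forall w, (mu (cylinder w) = \sum_(a <- A) mu (cylinder (a :: w)))%E.
Hypothesis pis : pisot beta.
Hypothesis nuE : forall B : set (measurableTypeR R), measurable B ->
  nu B = mu (phiplus beta @^-1` B).

Lemma image_measure_setT : nu setT = 1%E.
Proof. by rewrite nuE // preimage_setT probability_setT. Qed.

Hypothesis hF : forall z, Zbeta beta z -> z != 0 ->
  (fun k : nat => Normc.normc (fourier nu (z * beta ^+ k))) @ \oo --> 0.

(** Markov's inequality for [f], once shift invariance has replaced the event X in [S] by the event
    that the shifted sequence is mapped into [S]; there [f] is at least 1 at X, outside a null
    set. *)
Lemma measure_le_integral (f : R -> R) (S : set R) (k : nat) (D : R) :
  (forall a, a \in A -> `|a%:~R| <= D) ->
  nu.-integrable setT (EFin \o f) -> (forall s, 0 <= f s) ->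
  measurable (S : set (measurableTypeR R)) ->
  (forall (x : nat -> int) (F : R), (forall j, `|(x j)%:~R| <= D) -> S F ->
     1 <= f (beta ^- k * (digit_poly beta x k + F))) ->
  (nu S <= (\int[nu]_s f s)%:E)%E.
Proof.
move=> AD intf f0 mS hf.
have beta0 : beta ^+ k != 0 by rewrite expf_neq0 // gt_eqF // (lt_trans _ pis.1).
have mf : measurable_fun setT f by apply/measurable_EFinP; exact: measurable_int intf.
pose U : set (measurableTypeR R) := [set s | 1 <= f s].
have mU : measurable U.
  rewrite (_ : U = f @^-1` `[1, +oo[%classic).
    by rewrite -[X in measurable X]setTI; exact: mf.
  by apply/seteqP; split=> s; rewrite /U /= in_itv /= andbT.
have mphi (B : set (measurableTypeR R)) : measurable B ->
    measurable (phiplus beta @^-1` B : set seqspace).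
  by move=> mB; rewrite -[X in measurable X]setTI; exact: measurable_phiplus.
pose Z := [set x : seqspace | exists j, x j \notin A].
have mZ : measurable Z.
  rewrite (_ : Z = \bigcup_j [set x | x j \notin A]).
    by apply: bigcupT_measurable => j; exact: (measurable_coord_set [set a | a \notin A]).
  by apply/seteqP; split=> [x [j xj]|x [j _ xj]]; exists j.
apply: (@le_trans _ _ (nu U)).
  rewrite !nuE // -(shift_invariant uA mu_sum k (mphi _ mS)).
  apply: (@le_trans _ _ (mu ((phiplus beta @^-1` U) `|` Z))).
    apply: le_measure; rewrite ?inE.
    - by apply: measurable_preimage_seqshift; exact: mphi.
    - by apply: measurableU => //; exact: mphi.
    move=> x /= Sx; have [xZ|xZ] := pselect (Z x); [by right|left].
    have xD j : `|(x j)%:~R| <= D.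
      by apply: AD; apply/negPn/negP => xj; apply: xZ; exists j.
    rewrite /U /= -[phiplus beta x](mulKf beta0) (phiplus_split _ pis.1 xD).
    exact: hf.
  have Z0 : mu Z = 0%E by exact: (measure_coord_notin uA mu_sum).
  apply: le_trans (measureU2 mu (mphi _ mU) mZ) _.
  by rewrite [X in (_ + X <= _)%E](_ : _ = 0%E) ?adde0.
rewrite /Rintegral fineK; last exact: integrable_fin_num.
rewrite -[leLHS]mul1e -integral_cst //.
apply: (@le_trans _ _ (\int[nu]_(s in U) (f s)%:E)%E).
  apply: ge0_le_integral => //.
  by apply/measurable_EFinP; exact: measurable_funTS.
apply: ge0_subset_integral => //; first by apply/measurable_EFinP.
by move=> s _; rewrite lee_fin.
Qed.

Lemma interval_bound : exists2 C : R, 0 <= C &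
  forall a b : R, a < b -> (nu `]a, b]%classic <= (C * (b - a))%:E)%E.
Proof.
have nu1 := image_measure_setT; have nuoo : (nu setT < +oo)%E by rewrite nu1 ltry.
have beta0 : beta != 0 by rewrite gt_eqF // (lt_trans _ pis.1).
have [D D0 AD] := int_seq_bound R A.
have [c c0 [C1 hC1]] := trig_majorant pis D0.
(* [L] is fixed while [k] goes to infinity: the bound by the integral holds for every [k], hence for
   its limit, the mean of the majorant. *)
have small (L : nat) (a b : R) : (0 < L)%N -> b - a <= 2 * c / L%:R ->
    (nu `]a, b]%classic <= (C1 / L%:R)%:E)%E.
  move=> L0 ab; pose x0 := (a + b) / 2.
  have [I [kappa [zeta [phi [zZ hmean h0 h1]]]]] := hC1 L x0 L0.
  have hlim := @trigsum_limit _ _ _ nu1 hF I kappa zeta phi zZ.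
  have hk k : (nu `]a, b]%classic <= (\int[nu]_s trigsum kappa zeta phi (beta ^+ k * s))%:E)%E.
    apply: (@measure_le_integral _ _ k D) => //.
    - exact: (integrable_trigsum nu1 _ _ _ _).1.
    - move=> x F xD; rewrite /= in_itv /= => /andP[aF Fb].
      rewrite mulrA divff ?expf_neq0 // mul1r; apply: h1 => //.
      have : 2 * c / L%:R = c / L%:R + c / L%:R by ring.
      by move=> h; apply/ler_normlP; rewrite /x0; split; lra.
  have nufin : nu `]a, b]%classic \is a fin_num.
    rewrite ge0_fin_numE // (le_lt_trans _ nuoo) // le_measure ?inE //.
  rewrite -(fineK nufin) lee_fin; apply: le_trans hmean.
  by apply: (cvgr_to_ge hlim); apply: nearW => k; rewrite -lee_fin fineK.
have C10 : 0 <= C1.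
  have := small 1%N 0 0 isT; rewrite subrr !divr1 => /(_ (mulr_ge0 (ler0n _ 2) (ltW c0))) h.
  by rewrite -lee_fin; apply: le_trans h; exact: measure_ge0.
(* One constant for two cases: [nu <= 1] suffices for intervals of length at least [c], and [small]
   handles the shorter ones. *)
exists ((1 + C1) / c); first by rewrite divr_ge0 ?addr_ge0 // ltW.
move=> a b ab; have h0 : 0 < b - a by rewrite subr_gt0.
have [hc|hc] := leP c (b - a).
  apply: (@le_trans _ _ 1%E); first by rewrite -nu1 le_measure ?inE.
  rewrite lee_fin mulrAC ler_pdivlMr // mul1r (le_trans hc) //.
  by rewrite ler_peMl ?(ltW h0) // lerDl.
have ch1 : 1 <= c / (b - a) by rewrite ler_pdivlMr // mul1r ltW.
have c20 : 0 <= 2 * c / (b - a) by rewrite divr_ge0 ?mulr_ge0 ?ltW.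
(* [L] is the floor of [2 y] with [y = c / (b - a) >= 1], so [y <= L <= 2 y]: [small] applies, and
   [C1 / L] is still of order [b - a]. *)
have /andP[L1 L2] := truncn_itv c20; set L := Num.truncn _ in L1 L2.
have Lc : c / (b - a) <= L%:R.
  by move: L2 ch1; rewrite -natr1 -mulrA; lra.
have L0 : (0 < L)%N by rewrite -(ltr0n R); apply: lt_le_trans Lc; exact: lt_le_trans ch1.
apply: le_trans (small L a b L0 _) _.
  by rewrite ler_pdivlMr ?ltr0n // mulrC -ler_pdivlMr.
rewrite lee_fin ler_pdivrMr ?ltr0n //.
have -> : (1 + C1) / c * (b - a) * L%:R = (1 + C1) * (L%:R / (c / (b - a))).
  by field; rewrite !gt_eqF.
have hL : 1 <= L%:R / (c / (b - a)) by rewrite ler_pdivlMr ?divr_gt0 // mul1r.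
by rewrite (le_trans (_ : C1 <= 1 + C1)) ?lerDr // ler_peMr // addr_ge0.
Qed.

End interval_bound.

(** * The Riemann-Lebesgue lemma *)

Lemma integral_cos_affine (R : realType) (a b w phi : R) : a < b -> w != 0 ->
  \int[lebesgue_measure]_(x in `]a, b]) cos (w * x + phi)
  = (sin (w * b + phi) - sin (w * a + phi)) / w.
Proof.
move=> ab w0.
have cc : continuous (fun x : R => cos (w * x + phi)).
  move=> s; apply: (continuous_comp (f := fun s => w * s + phi)); last exact: continuous_cos.
  by apply: cvgD; [apply: cvgM; [exact: cvg_cst|exact: cvg_id]|exact: cvg_cst].
pose F (x : R) := sin (w * x + phi) / w.
have dF (x : R) : is_derive x 1 F (cos (w * x + phi)).
  rewrite /F; apply: is_derive_eq.
  by rewrite scaler0 add0r addr0 /GRing.scale /= mulr1 mulrC mulfK.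
have cF : continuous F.
  by move=> x; apply/differentiable_continuous/derivable1_diffP; have [] := dF x.
have int_oc : lebesgue_measure.-integrable `]a, b] (EFin \o (fun x => cos (w * x + phi))).
  apply: measurable_bounded_integrable => //.
  - by have := lebesgue_measure_itv `]a, b]; rewrite /= lte_fin ab -EFinB => ->; rewrite ltry.
  - by apply: measurable_funTS; exact: continuous_measurable_fun.
  - exists 1; split; first exact: num_real.
    move=> M M1 x _; apply: le_trans (ltW M1).
    by rewrite /= ler_norml cos_geN1 cos_le1.
rewrite Rintegral_itv_obnd_cbnd // /Rintegral.
have -> : (\int[lebesgue_measure]_(x in `[a, b]) (cos (w * x + phi))%:E
    = (F b)%:E - (F a)%:E)%E.
  apply: continuous_FTC2 => //.
  - exact: continuous_subspaceT.
  - split.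
    + by move=> x _; have [] := dF x.
    + exact/cvg_at_right_filter/cF.
    + exact/cvg_at_left_filter/cF.
  - by move=> x _; rewrite derive1E; have [_ ->] := dF x.
by rewrite /F -EFinB /= -mulrBl.
Qed.

(** * Weak convergence to zero of bounded functions *)

Section weak_convergence_to_0.
Context d (T : measurableType d) (R : realType) (m : {measure set T -> \bar R})
  (w : nat -> T -> R).
Hypothesis mw : forall k, measurable_fun setT (w k).
Hypothesis w1 : forall k x, `|w k x| <= 1.

Local Notation integ f := (m.-integrable setT (EFin \o f)).

(** The test functions against which the sequence [w] tends weakly to 0. *)
Definition weak0 (f : T -> R) := (fun k => \int[m]_x (f x * w k x)) @ \oo --> 0.

Lemma integrable_mulw (f : T -> R) k : integ f -> integ (fun x => f x * w k x).
Proof.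
move=> intf; apply: le_integrable (intf) => //.
  apply/measurable_EFinP; apply: measurable_funM => //.
  by apply/measurable_EFinP; exact: measurable_int intf.
by move=> x _; rewrite /= lee_fin normrM ler_piMr.
Qed.

Lemma integrableD_EFin (f g : T -> R) : integ f -> integ g -> integ (fun x => f x + g x).
Proof. by move=> fi gi; rewrite (_ : EFin \o _ = (EFin \o f) \+ (EFin \o g))%E //; exact: integrableD. Qed.

Lemma integrableZ_EFin (c : R) (f : T -> R) : integ f -> integ (fun x => c * f x).
Proof. by move=> fi; rewrite (_ : EFin \o _ = fun x => c%:E * (EFin \o f) x)%E //; exact: integrableZl. Qed.

Lemma weak0_0 : weak0 (cst 0).
Proof.
rewrite /weak0 (_ : (fun k => _) = cst 0); first exact: cvg_cst.
apply/funext => k; rewrite /Rintegral integral0_eq // => x _; by rewrite mul0r.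
Qed.

Lemma weak0D (f g : T -> R) : integ f -> integ g -> weak0 f -> weak0 g ->
  weak0 (fun x => f x + g x).
Proof.
move=> intf intg f0 g0; rewrite /weak0 -[X in _ --> X]addr0.
rewrite (_ : (fun k => _) = fun k => \int[m]_x (f x * w k x) + \int[m]_x (g x * w k x)).
  exact: cvgD.
apply/funext => k; rewrite -RintegralD //; try exact: integrable_mulw.
by apply: eq_Rintegral => x _; rewrite mulrDl.
Qed.

Lemma weak0Z (c : R) (f : T -> R) : integ f -> weak0 f -> weak0 (fun x => c * f x).
Proof.
move=> intf f0; rewrite /weak0 -[X in _ --> X](mulr0 c).
rewrite (_ : (fun k => _) = fun k => c * \int[m]_x (f x * w k x)).
  by apply: cvgM => //; exact: cvg_cst.
apply/funext => k; rewrite -RintegralZl //; last exact: integrable_mulw.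
by apply: eq_Rintegral => x _; rewrite mulrA.
Qed.

(** Dominated convergence makes [h n] tend to [f] in L1; as [|w k| <= 1], replacing [f] by one fixed
    [h N] changes the integrals by at most [e / 2], uniformly in [k]. *)
Lemma weak0_dominated (h : nat -> T -> R) (f g : T -> R) :
  (forall n, integ (h n)) -> integ f -> integ g ->
  (forall x, h ^~ x @ \oo --> f x) -> (forall n x, `|h n x| <= g x) ->
  (forall n, weak0 (h n)) -> weak0 f.
Proof.
move=> inth intf intg hf hg h0.
have [_ L1 _] : [/\ m.-integrable setT (EFin \o f),
    (\int[m]_x `|(EFin \o h n) x - (EFin \o f) x|)%E @[n --> \oo] --> 0%E &
    (\int[m]_x (EFin \o h n) x)%E @[n --> \oo] --> (\int[m]_x (EFin \o f) x)%E].
  apply: (@dominated_convergence _ _ _ _ _ _ _ _ (EFin \o g)) => //.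
  - by move=> n; exact: measurable_int (inth n).
  - exact: measurable_int intf.
  - by apply: aeW => x _; apply: cvg_EFin; [exact: nearW|exact: hf].
  - by apply: aeW => x n _; rewrite /= lee_fin.
apply/cvgrPdist_le => e e0.
have e20 : 0 < e / 2 by rewrite divr_gt0.
have [_ /cvgrPdist_le/(_ _ e20)[N _ hN]] := (fine_cvgP _ _).1 L1.
have := hN N (leqnn N); rewrite /= sub0r normrN => hNN.
have fh : integ (fun x => f x - h N x).
  rewrite (_ : EFin \o _ = (EFin \o f) \- (EFin \o h N))%E //.
  exact: integrableB.
have /cvgrPdist_le/(_ _ e20) := h0 N; apply: filterS => k.
rewrite !sub0r !normrN => hk.
have -> : \int[m]_x (f x * w k x) =
    \int[m]_x ((f x - h N x) * w k x) + \int[m]_x (h N x * w k x).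
  rewrite -RintegralD //; try exact: integrable_mulw.
  by apply: eq_Rintegral => x _; rewrite -mulrDl subrK.
apply: le_trans (ler_normD _ _) _; rewrite [leRHS](splitr e); apply: lerD => //.
apply: le_trans (le_normr_Rintegral _ _) _ => //; first exact: integrable_mulw.
apply: le_trans (le_trans _ (ler_norm _)) hNN.
apply: le_Rintegral => //.
- by apply: integrable_norm; exact: integrable_mulw.
- rewrite (_ : EFin \o _ = fun x => `|(EFin \o (fun x => (f x - h N x)%R)) x|%E).
    exact: integrable_abse.
  by apply/funext => x; rewrite /= distrC.
- move=> x _; rewrite normrM [leRHS]distrC.
  by rewrite ler_piMr.
Qed.

Lemma integrable_indic_fin (S : set T) : measurable S -> (m S < +oo)%E -> integ (\1_S).
Proof.
move=> mS Soo; apply/integrableP; split.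
  by apply/measurable_EFinP; exact: measurable_indic.
under eq_integral do rewrite /= normr_nat.
by rewrite integral_indic // setIT.
Qed.

Lemma weak0_indicU (S1 S2 : set T) : measurable S1 -> measurable S2 ->
  S1 `&` S2 = set0 -> (m S1 < +oo)%E -> (m S2 < +oo)%E ->
  weak0 (\1_S1) -> weak0 (\1_S2) -> weak0 (\1_(S1 `|` S2)).
Proof.
move=> mS1 mS2 S12 S1oo S2oo w1' w2'.
rewrite (_ : \1_(S1 `|` S2) = fun x => \1_S1 x + \1_S2 x); last first.
  apply/funext => x; rewrite !indicE in_setU.
  have [x1|] := boolP (x \in S1); have [x2|] := boolP (x \in S2) => //=; rewrite ?addr0 ?add0r //.
  have : (S1 `&` S2) x by split; exact: set_mem.
  by rewrite S12.
by apply: weak0D => //; exact: integrable_indic_fin.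
Qed.

End weak_convergence_to_0.

Section weak_convergence_density.
Context d (T : measurableType d) (R : realType) (m : {measure set T -> \bar R})
  (w : nat -> T -> R).
Hypothesis mw : forall k, measurable_fun setT (w k).
Hypothesis w1 : forall k x, `|w k x| <= 1.
Variable D : set T.
Hypothesis mD : measurable D.
Hypothesis Doo : (m D < +oo)%E.

Let fin_setID (S : set T) : measurable S -> (m (S `&` D) < +oo)%E.
Proof.
move=> mS; apply: le_lt_trans Doo; apply: le_measure; rewrite ?inE //.
exact: measurableI.
Qed.

Let int_setID (S : set T) : measurable S -> m.-integrable setT (EFin \o \1_(S `&` D)).
Proof.
move=> mS; apply: integrable_indic_fin; first exact: measurableI.
exact: fin_setID.
Qed.

(** Dynkin's argument inside [D], whose finite measure keeps the indicators integrable: complements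
    are subtracted from the indicator of [D], and the same indicator dominates disjoint unions. *)
Lemma weak0_indic (G : set (set T)) : @measurable _ T = <<s G >> -> setI_closed G ->
  weak0 m w \1_D -> (forall S, G S -> weak0 m w \1_(S `&` D)) ->
  forall S, measurable S -> weak0 m w \1_(S `&` D).
Proof.
move=> mG GI wD wG; rewrite mG.
apply: dynkin_induction => //; first by rewrite setTI.
- move=> S mS wS.
  rewrite (_ : \1_(~` S `&` D) = fun x => \1_D x + (-1) * \1_(S `&` D) x); last first.
    apply/funext => x; rewrite !indicE !in_setI in_setC.
    by case: (x \in S); case: (x \in D); rewrite /= ?mulN1r ?subrr ?oppr0 ?addr0.
  apply: weak0D => //.
  + exact: integrable_indic_fin.
  + by apply: integrableZ_EFin; exact: int_setID.
  + by apply: weak0Z => //; exact: int_setID.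
- move=> F mF tF wF; pose U n := \big[setU/set0]_(i < n) F i.
  have mU n : measurable (U n) by exact: bigsetU_measurable.
  apply: (@weak0_dominated _ _ _ _ _ mw w1 (fun n => \1_(U n `&` D)) _ \1_D).
  + by move=> n; exact: int_setID.
  + by apply: int_setID; exact: bigcupT_measurable.
  + exact: integrable_indic_fin.
  + move=> x; have [[i _ Fx]|nFx] := pselect ((\bigcup_k F k) x).
      apply: cvg_near_cst; exists i.+1 => // n /= ni.
      rewrite !indicE !in_setI; congr ((_ && _)%:R).
      rewrite (mem_set (ex_intro2 _ _ i I Fx : (\bigcup_k F k) x)) mem_set //.
      by rewrite /U -bigcup_mkord; exists i.
    rewrite (_ : (fun n => _) = cst (\1_(\bigcup_k F k `&` D) x)); first exact: cvg_cst.
    apply/funext => n; rewrite !indicE !in_setI; congr ((_ && _)%:R).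
    rewrite !memNset //.
    by rewrite /U -bigcup_mkord => -[i /= _ Fi]; apply: nFx; exists i.
  + move=> n x; rewrite !indicE in_setI normr_nat ler_nat.
    by case: (x \in U n); case: (x \in D).
  + elim=> [|n IH].
      by rewrite /U big_ord0 set0I indic0; exact: weak0_0.
    rewrite /U big_ord_recr /= setIUl; apply: weak0_indicU => //.
    * exact: (measurableI _ _ (mU n) mD).
    * exact: (measurableI _ _ (mF n) mD).
    * apply/seteqP; split=> // x [[+ _] [Fx _]].
      rewrite -bigcup_mkord => -[i /= ni Fi].
      have /trivIsetP/(_ i n I I) := tF; rewrite neq_ltn ni => /(_ isT) FF.
      by have : (F i `&` F n) x by []; rewrite FF.
    * exact: (fin_setID (mU n)).
    * exact: (fin_setID (mF n)).
Qed.

Import HBNNSimple.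

(** Simple functions increase to [f], and [f] itself dominates them. *)
Lemma weak0_ge0 (f : T -> R) : (forall S, measurable S -> weak0 m w \1_(S `&` D)) ->
  (forall x, 0 <= f x) -> m.-integrable setT (EFin \o f) ->
  (forall x, ~ D x -> f x = 0) -> weak0 m w f.
Proof.
move=> wD f0 intf fD.
have mf : measurable_fun setT (EFin \o f) by exact: measurable_int intf.
pose h := nnsfun_approx measurableT mf.
have hf x : h ^~ x @ \oo --> f x.
  have := @cvg_nnsfun_approx _ _ _ _ measurableT _ mf (fun x _ => f0 x) x I.
  by move/fine_cvgP => [_].
have hle n x : h n x <= f x.
  apply: (cvgr_to_ge (hf x)); exists n => // k /= nk.
  by move: x; apply/lefP; exact: nd_nnsfun_approx.
have wh n : m.-integrable setT (EFin \o h n) /\ weak0 m w (h n).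
  have [r hr] : exists r : seq R, forall x,
      h n x = \sum_(y <- r) y * \1_(h n @^-1` [set y]) x.
    by eexists => x; rewrite fimfunE fsbig_finite.
  (* The simple function lies below [f], which vanishes off [D], so its level sets for nonzero
     values are contained in [D]. *)
  rewrite (_ : h n = (fun x => \sum_(y <- r) y * \1_(h n @^-1` [set y] `&` D) x) :> (T -> R)); last first.
    apply/funext => x; rewrite hr.
    apply: eq_bigr => y _; have [->|y0] := eqVneq y 0; first by rewrite !mul0r.
    congr (_ * _); rewrite !indicE in_setI; congr (_%:R).
    have [xy|] := boolP (x \in h n @^-1` [set y]) => //=.
    suff Dx : D x by rewrite (mem_set Dx).
    apply: contrapT => nDx; move/set_mem: xy => /= hy.
    have := hle n x; rewrite fD // hy leNgt lt_neqAle eq_sym y0 /=.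
    by rewrite -hy fun_ge0.
  have mS y : measurable (h n @^-1` [set y]) by exact: (measurable_funPTI (h n) (measurable_set1 y)).
  elim: r {hr} => [|y r [IH1 IH2]].
    rewrite (_ : (fun x => _) = cst 0); last by apply/funext => x; rewrite big_nil.
    by split; [exact: integrable0|exact: weak0_0].
  rewrite (_ : (fun x => _) = fun x => y * \1_(h n @^-1` [set y] `&` D) x +
    \sum_(y <- r) y * \1_(h n @^-1` [set y] `&` D) x); last first.
    by apply/funext => x; rewrite big_cons.
  have i1 := integrableZ_EFin y (int_setID (mS y)).
  split; first exact: integrableD_EFin.
  by apply: weak0D => //; apply: weak0Z => //; [exact: int_setID|exact: wD].
apply: (@weak0_dominated _ _ _ _ _ mw w1 h _ f) => //.
- by move=> n; exact: (wh n).1.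
- by move=> n x; rewrite ger0_norm.
- by move=> n; exact: (wh n).2.
Qed.

End weak_convergence_density.

Lemma Rintegral_indicM d (T : measurableType d) (R : realType)
    (m : {measure set T -> \bar R}) (D : set T) (f : T -> R) :
  \int[m]_x (\1_D x * f x) = \int[m]_(x in D) f x.
Proof.
rewrite [RHS]Rintegral_mkcond; apply: eq_Rintegral => x _.
by rewrite patchE indicE; case: (x \in D); rewrite ?mul1r ?mul0r.
Qed.

(** The integral over the interval is at most [2 / |t k|] in absolute value. *)
Lemma weak0_cos_itv (R : realType) (t : nat -> R) (phi a b : R) : a < b ->
  (forall k, t k != 0) -> (fun k => (t k)^-1) @ \oo --> 0 ->
  weak0 lebesgue_measure (fun k s => cos (t k * s + phi)) \1_(`]a, b]%classic).
Proof.
move=> ab t0 ht; rewrite /weak0.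
rewrite (_ : (fun k => _) = fun k => (sin (t k * b + phi) - sin (t k * a + phi)) * (t k)^-1).
  apply/norm_cvg0P; have h2 : (fun k => 2 * `|(t k)^-1|) @ \oo --> 0.
    rewrite -[X in _ --> X](mulr0 2); apply: cvgM; first exact: cvg_cst.
    exact/norm_cvg0P.
  apply: (squeeze_cvgr _ (cvg_cst 0) h2); apply: nearW => k.
  rewrite normr_ge0 normrM ler_wpM2r //= (le_trans (ler_normB _ _)) //.
  by rewrite (_ : 2 = 1 + 1 :> R) // lerD // ler_norml sin_geN1 sin_le1.
by apply/funext => k; rewrite Rintegral_indicM integral_cos_affine.
Qed.

(** The Radon-Nikodym density reduces the claim to weak convergence against an integrable function.
    This is obtained for intervals, then for measurable parts of the bounded [D n], then for the
    density cut off to [D n], and by domination for the density. *)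
Lemma riemann_lebesgue (R : realType)
    (nu : {finite_measure set (measurableTypeR R) -> \bar R}) (t : nat -> R) (phi : R) :
  nu `<< lebesgue_measure -> (forall k, t k != 0) -> (fun k => (t k)^-1) @ \oo --> 0 ->
  (fun k => \int[nu]_s cos (t k * s + phi)) @ \oo --> 0.
Proof.
move=> dom t0 ht.
pose w k (s : measurableTypeR R) := cos (t k * s + phi).
have mw k : measurable_fun setT (w k) by exact: measurable_cos_affine.
have w1 k x : `|w k x| <= 1 by rewrite ler_norml cos_geN1 cos_le1.
have nuoo : (nu setT < +oo)%E by rewrite -ge0_fin_numE ?fin_num_measure.
pose D (n : nat) : set (measurableTypeR R) := `]- n.+1%:R, n.+1%:R]%classic.
have mD n : measurable (D n) by exact: measurable_itv.
have D0 n : - n.+1%:R < n.+1%:R :> R by rewrite gtrN.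
have Doo n : (lebesgue_measure (D n) < +oo)%E.
  have := lebesgue_measure_itv `]- n.+1%:R, (n.+1%:R : R)].
  by rewrite /= lte_fin D0 -EFinB => ->; rewrite ltry.
have wD n : weak0 lebesgue_measure w \1_(D n) by exact: weak0_cos_itv.
have wS n (S : set (measurableTypeR R)) : measurable S ->
    weak0 lebesgue_measure w \1_(S `&` D n).
  apply: (@weak0_indic _ (measurableTypeR R) R lebesgue_measure w mw w1
    (D n) (mD n) (Doo n) (@ocitv R)) => //.
  - exact: ocitvI.
  - move=> {}S oS; have : ocitv (S `&` D n).
      by apply: ocitvI => //; exists (- n.+1%:R, n.+1%:R).
    move=> /ocitvP[->|[[a b] /= ab ->]]; last exact: weak0_cos_itv.
    by rewrite indic0; exact: weak0_0.
pose g := Radon_Nikodym_SigmaFinite.f nu lebesgue_measure.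
pose f x := fine (g x).
have gE x : g x = (f x)%:E by rewrite /f fineK // Radon_Nikodym_SigmaFinite.f_fin_num.
have f0 x : 0 <= f x by rewrite fine_ge0 // Radon_Nikodym_SigmaFinite.f_ge0.
have gE' : g = EFin \o f by apply/funext => x; rewrite gE.
have intf : lebesgue_measure.-integrable setT (EFin \o f).
  by rewrite -gE'; exact: Radon_Nikodym_SigmaFinite.f_integrable.
have mf : measurable_fun setT f by apply/measurable_EFinP; exact: measurable_int intf.
pose fD n (x : measurableTypeR R) := f x * \1_(D n) x.
have fDle n x : 0 <= fD n x <= f x.
  by rewrite /fD indicE; case: (x \in D n); rewrite ?mulr1 ?mulr0 f0 lexx.
have intfD n : lebesgue_measure.-integrable setT (EFin \o fD n).
  apply: le_integrable (intf) => //.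
    apply/measurable_EFinP; apply: (measurable_funM mf).
    exact: (measurable_indic (mD n)).
  move=> x _; have /andP[h1 h2] := fDle n x.
  by rewrite /= lee_fin !ger0_norm.
have wf : weak0 lebesgue_measure w f.
  apply: (@weak0_dominated _ _ _ _ _ mw w1 fD f f) => //.
  - move=> x; apply: cvg_near_cst; near=> n.
    suff Dx : D n x by rewrite /fD indicE (mem_set Dx) mulr1.
    rewrite /D /= in_itv /=.
    have xn : `|x| < n.+1%:R.
      apply: lt_le_trans (truncnS_gt _) _; rewrite ler_nat ltnS.
      by near: n; exists (Num.truncn `|x|).
    by move/ltr_normlP: xn => [h1 h2]; apply/andP; split; lra.
  - by move=> n x; have /andP[h1 h2] := fDle n x; rewrite ger0_norm.
  - move=> n; apply: (@weak0_ge0 _ _ _ lebesgue_measure w mw w1 (D n) (mD n) (Doo n) _ (wS n)) => //.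
    + by move=> x; have /andP[] := fDle n x.
    + by move=> x nDx; rewrite /fD indicE memNset // mulr0.
rewrite (_ : (fun k => _) = fun k => \int[lebesgue_measure]_x (f x * w k x)) //.
apply/funext => k.
have intw : nu.-integrable setT (EFin \o w k) by exact: (@bounded_integrable _ _ _ _ _ 1).
have int1 : nu.-integrable setT (EFin \o cst 1).
  by apply: (@bounded_integrable _ _ _ _ _ 1) => // x; rewrite normr1.
(* The change of variables is applied to [1 + w k], which is nonnegative; the constant contributes
   the total mass of [nu] on both sides and cancels. *)
have := @Radon_Nikodym_SigmaFinite.change_of_variables _ _ _ nu lebesgue_measure dom
  (EFin \o (fun x => 1 + w k x)) setT.
rewrite -/g gE' => /(_ _ _ _)/(congr1 fine) H.
have : \int[lebesgue_measure]_x (f x + f x * w k x) = \int[nu]_x (1 + w k x).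
  rewrite /Rintegral -H //.
  - by congr fine; apply: eq_integral => x _; rewrite /= -EFinM; congr EFin; ring.
  - by move=> x; rewrite lee_fin; have /ler_normlP[] := w1 k x; lra.
  - by apply/measurable_EFinP; apply: measurable_funD.
rewrite RintegralD //; last exact: integrable_mulw.
rewrite RintegralD // Rintegral_cst // mul1r.
have -> : \int[lebesgue_measure]_x f x = fine (nu setT).
  by rewrite (Radon_Nikodym_SigmaFinite.f_integral dom measurableT) -/g gE'.
by move/addrI => ->.
Unshelve. all: by end_near. Qed.

(** The sine is a cosine with phase [- (pi / 2)], so both parts of [fourier] tend to 0, and the
    modulus is at most the sum of their absolute values. *)
Lemma fourier_cvg0 (R : realType) (beta z : R)
    (nu : {finite_measure set (measurableTypeR R) -> \bar R}) :
  1 < beta -> z != 0 -> nu `<< lebesgue_measure ->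
  (fun k : nat => Normc.normc (fourier nu (z * beta ^+ k))) @ \oo --> 0.
Proof.
move=> beta1 z0 dom; have beta0 : 0 < beta by apply: lt_trans beta1.
pose t k := 2 * pi * z * beta ^+ k.
have c0 : 2 * pi * z != 0 by rewrite !mulf_neq0 // gt_eqF // pi_gt0.
have t0 k : t k != 0 by rewrite mulf_neq0 // expf_neq0 // gt_eqF.
have ht : (fun k => (t k)^-1) @ \oo --> 0.
  rewrite (_ : (fun k => _) = geometric (2 * pi * z)^-1 beta^-1).
    by apply: cvg_geometric; rewrite normfV gtr0_norm // invf_lt1.
  by apply/funext => k; rewrite /t /geometric /= invfM exprVn.
have hc := riemann_lebesgue 0 dom t0 ht.
have hs := riemann_lebesgue (- (pi / 2)) dom t0 ht.
have hcs : (fun k => `|\int[nu]_s cos (t k * s + 0)| +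
    `|\int[nu]_s cos (t k * s + (- (pi / 2)))|) @ \oo --> 0.
  by rewrite -[X in _ --> X](addr0 0); apply: cvgD; exact/norm_cvg0P.
apply: (squeeze_cvgr _ (cvg_cst 0) hcs); apply: nearW => k.
rewrite /fourier /=.
have -> : (fun x => cos (2 * pi * x * (z * beta ^+ k))) = (fun x => cos (t k * x + 0)).
  by apply/funext => x; rewrite addr0; congr cos; rewrite /t; ring.
have -> : (fun x => sin (2 * pi * x * (z * beta ^+ k))) = (fun x => cos (t k * x + (- (pi / 2)))).
  by apply/funext => x; rewrite cosBpihalf; congr sin; rewrite /t; ring.
set a := Rintegral _ _ _; set b := Rintegral _ _ _.
rewrite sqrtr_ge0 sqrrN /= -[leRHS]ger0_norm ?addr_ge0 // -sqrtr_sqr ler_sqrt ?sqr_ge0 //.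
by rewrite sqrrD !real_normK ?num_real // [leRHS]addrAC lerDl mulrn_wge0 // mulr_ge0.
Qed.

(** Equips the measure with the finite measure structure that [riemann_lebesgue] expects, leaving
    the measure itself unchanged. *)
Lemma finite_measure_pack d (T : measurableType d) (R : realType)
    (nu : {measure set T -> \bar R}) : fin_num_fun nu ->
  exists nu' : {finite_measure set T -> \bar R}, nu' = nu :> {measure set T -> \bar R}.
Proof.
case: nu => f c fin.
pose m := Measure_isFinite.Build d T R (Measure.Pack c) fin.
pose nu' : {finite_measure set T -> \bar R} := HB.pack f (Measure.Pack c) m.
by exists nu'.
Qed.

(** * The equivalence *)

Unset Implicit Arguments.

Theorem theorem14 (R : realType) (n : nat)
    (A : seq int) (E : rel 'I_n.+1) (ell : 'I_n.+1 -> 'I_n.+1 -> int)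
    (beta lambda : R) (vL vR : 'cV[R]_n.+1)
    (mu : probability seqspace R)
    (nu : {measure set (measurableTypeR R) -> \bar R}) :
  uniq A ->
  (forall i j, E i j -> ell i j \in A) ->
  primitive_mx (adjmx R A E ell) ->
  0 < lambda ->
  (forall i, 0 < vL i 0) -> (forall i, 0 < vR i 0) ->
  vL^T *m adjmx R A E ell = lambda *: vL^T ->
  adjmx R A E ell *m vR = lambda *: vR ->
  (vL^T *m vR) 0 0 = 1 ->
  (forall w : seq int,
     mu (cylinder w) =
     (lambda ^- size w *
        (vL^T *m (\prod_(a <- w) labmx R E ell a) *m vR) 0 0)%:E) ->
  pisot beta ->
  (forall B : set (measurableTypeR R), measurable B ->
     nu B = mu (phiplus beta @^-1` B)) ->
  (nu `<< lebesgue_measure <->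
   forall z, Zbeta beta z -> z != 0 ->
     (fun k : nat => Normc.normc (fourier nu (z * beta ^+ k))) @ \oo --> 0).
Proof.
move=> uA _ _ l0 _ _ hL _ _ hmu pis nuE.
have mu_sum := cylinder_transfer l0 hL hmu.
have nu1 := image_measure_setT nuE.
split=> [dom z _ z0|hF]; last first.
  have [C C0 hC] := interval_bound uA mu_sum pis nuE hF.
  exact: null_dominates_of_interval_bound hC.
have nufin : fin_num_fun nu.
  move=> B mB; rewrite ge0_fin_numE //; apply: (@le_lt_trans _ _ 1%E); last exact: ltry.
  by rewrite -nu1; apply: le_measure; rewrite ?inE.
have [nu' nu'E] := finite_measure_pack nufin.
by move: dom; rewrite -nu'E => dom; exact: fourier_cvg0 pis.1 z0 dom.
Qed.
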